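(* Let $k\in\mathbb{N}$ and $G\in M_{2-2k}^!$. Then for every discriminant $D>0$ and every $Q\in\mathcal{Q}_D$, $$ \mathcal{C}\left(\mathcal{D}^{2k-1}(G);Q\right)=0. $$
   Context: Throughout, $k\in\mathbb{N}=\{1,2,\dots\}$ is fixed, $\mathbb{H}$ is the upper half-plane, $z=x+iy\in\mathbb{H}$, and all modular objects are for $\mathrm{SL}_2(\mathbb{Z})$. $M_{w}^!$ is the space of weakly holomorphic modular forms of weight $w$ (meromorphic modular forms whose only possible poles are at the cusps). $\mathcal{D}=\frac{1}{2\pi i}\frac{\partial}{\partial z}$; for $G\in M_{2-2k}^!$, $\mathcal{D}^{2k-1}(G)$ is a weakly holomorphic modular form of weight $2k$. Regularized integral. If $f:\mathbb{H}\to\mathbb{C}$ is continuous with $f(z)=O(e^{c\,\mathrm{Im}(z)})$ for some $c>0$, uniformly in $\mathrm{Re}(z)$, as $\mathrm{Im}(z)\to\infty$, then for $z_0\in\mathbb{H}$ the integral $\int_{z_0}^{i\infty}e^{uiw}f(w)\,dw$ (path in a vertical strip) converges for $\mathrm{Re}(u)\gg0$; if it has an analytic continuation to $u=0$, $R.\int_{z_0}^{i\infty}f(w)\,dw$ is the value of this continuation at $u=0$. For a cusp $\mathfrak{a}=\sigma_{\mathfrak{a}}(i\infty)$, $\sigma_{\mathfrak{a}}\in\mathrm{SL}_2(\mathbb{Z})$, put $R.\int_{z_0}^{\mathfrak{a}}f(w)\,dw=R.\int_{\sigma_{\mathfrak{a}}^{-1}z_0}^{i\infty}(f|_2\sigma_{\mathfrak{a}})(w)\,dw$,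 with $(f|_2\left(\begin{smallmatrix}\alpha&\beta\\ \gamma&\delta\end{smallmatrix}\right))(w)=(\gamma w+\delta)^{-2}f\left(\frac{\alpha w+\beta}{\gamma w+\delta}\right)$, and for cusps $\mathfrak{a},\mathfrak{b}$ put $R.\int_{\mathfrak{a}}^{\mathfrak{b}}f=R.\int_{z_0}^{\mathfrak{b}}f+R.\int_{\mathfrak{a}}^{z_0}f$ for any $z_0\in\mathbb{H}$, where $R.\int_{\mathfrak{a}}^{z_0}=-R.\int_{z_0}^{\mathfrak{a}}$ (independent of $z_0$). Cycle integrals. A discriminant is an integer $\equiv0,1\pmod4$. For a discriminant $D>0$, $\mathcal{Q}_D$ is the set of integral binary quadratic forms $Q=[a,b,c]$, $Q(X,Y)=aX^2+bXY+cY^2$, with $b^2-4ac=D$. If $a\neq0$, $S_Q$ is the semicircle $\{z\in\mathbb{H}: a|z|^2+bx+c=0\}$, directed counterclockwise if $a>0$ and clockwise if $a<0$; if $a=0$, $S_Q$ is the vertical line given by the same equation, directed up from the real axis. If $D$ is not a square and $\gcd(a,b,c)=1$, let $g_Q=\left(\begin{smallmatrix}\frac{t+bu}{2}&cu\\-au&\frac{t-bu}{2}\end{smallmatrix}\right)$, where $(t,u)$ is the smallest positive solution of $t^2-Du^2=4$; if $\gcd(a,b,c)=g>1$, let $g_Q=g_{Q/g}$ (so $g_Q$ generates, up to sign, the group of automorphs of $Q$ in $\mathrm{SL}_2(\mathbb{Z})$). If $D$ is not a square, $C_Q$ is the directed arc of $S_Q$ from $z$ to $g_Qz$ for any $z\in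 S_Q$; if $D$ is a square, $C_Q=S_Q$. For $F$ continuous of weight $2k$ modularity, $\mathcal{C}(F;Q)=R.\int_{C_Q}F(z)Q(z,1)^{k-1}\,dz$; for non-square $D$ this is an ordinary integral over a compact arc and is independent of the choice of $z$; for square $D$ it is the regularized integral between the two cusps that are the endpoints of $S_Q$. *)

(* Defs.v *)
From Stdlib Require Import Reals ZArith.
From Coquelicot Require Import Coquelicot.

Open Scope C_scope.

Definition ZtoC (n : Z) : C := RtoC (IZR n).

Definition Cexp (z : C) : C := (exp (Re z) * cos (Im z), exp (Re z) * sin (Im z))%R.

Definition Cpow_Z (z : C) (n : Z) : C :=
  match n with
  | Z0 => 1
  | Zpos p => z ^ Pos.to_nat p
  | Zneg p => / (z ^ Pos.to_nat p)
  end.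

Definition upper_half_plane (z : C) : Prop := (0 < Im z)%R.

Record mat2 : Type := Mat2 { m11 : Z; m12 : Z; m21 : Z; m22 : Z }.

Definition SL2Z (g : mat2) : Prop :=
  (m11 g * m22 g - m12 g * m21 g = 1)%Z.

(* The inverse of g when g has determinant 1. *)
Definition mat2_inv (g : mat2) : mat2 :=
  Mat2 (m22 g) (- m12 g) (- m21 g) (m11 g).

Definition mobius (g : mat2) (z : C) : C :=
  (ZtoC (m11 g) * z + ZtoC (m12 g)) / (ZtoC (m21 g) * z + ZtoC (m22 g)).

Definition slash (w : Z) (f : C -> C) (g : mat2) (z : C) : C :=
  Cpow_Z (ZtoC (m21 g) * z + ZtoC (m22 g)) (- w) * f (mobius g z).

(* Functions on the upper half-plane are represented by functions on C whose
   values elsewhere are irrelevant. *)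
Definition holomorphic_on (U : C -> Prop) (f : C -> C) : Prop :=
  forall z : C, U z -> ex_derive (K := C_AbsRing) (V := C_NormedModule) f z.

(* With q = exp(2 pi i z), this says f = sum_(n >= 0) a_n q^(n - N): the Laurent
   expansion in q at the cusp has finite principal part. *)
Definition meromorphic_at_infinity (f : C -> C) : Prop :=
  exists (N : nat) (a : nat -> C),
    forall z : C, upper_half_plane z ->
      is_series (K := C_AbsRing) (V := C_NormedModule)
        (fun n : nat => a n * Cexp (2 * PI * Ci * INR n * z))
        (Cexp (2 * PI * Ci * INR N * z) * f z).

(* SL_2(Z) has a single class of cusps, so only i*oo has to be inspected. *)
Record weakly_holomorphic (w : Z) (f : C -> C) : Prop := {
  wh_holomorphic : holomorphic_on upper_half_plane f;
  wh_modular : forall (g : mat2) (z : C), SL2Z g -> upper_half_plane z ->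
    slash w f g z = f z;
  wh_cusp : meromorphic_at_infinity f
}.

(* (1 / (2 pi i)) d/dz.  [C_derive] is the complex derivative wherever that
   exists; it is total, with unspecified values elsewhere. *)
Definition calD (f : C -> C) (z : C) : C := C_derive f z / (2 * PI * Ci).

Definition calD_n (n : nat) (f : C -> C) : C -> C := Nat.iter n calD f.

Definition connected_set (U : C -> Prop) : Prop :=
  ~ exists A B : C -> Prop,
      open A /\ open B /\
      (forall z, U z -> A z \/ B z) /\
      (forall z, U z -> ~ (A z /\ B z)) /\
      (exists z, U z /\ A z) /\ (exists z, U z /\ B z).

(* int_(z0)^(i oo) e^(u i w) f(w) dw, along the vertical ray w = z0 + i s. *)
Definition is_damped_integral (f : C -> C) (z0 u v : C) : Prop :=
  is_RInt_gen (V := C_R_NormedModule)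
    (fun s : R => Cexp (u * Ci * (z0 + Ci * s)) * f (z0 + Ci * s) * Ci)
    (at_point 0%R) (Rbar_locally p_infty) v.

(* v is the value of R.int_(z0)^(i oo) f(w) dw: Phi is the analytic continuation,
   to a domain U containing 0, of the damped integral as a function of u. *)
Definition is_reg_integral (f : C -> C) (z0 v : C) : Prop :=
  exists (U : C -> Prop) (Phi : C -> C) (c : R),
    open U /\ connected_set U /\ holomorphic_on U Phi /\
    (forall u : C, (c < Re u)%R -> U u /\ is_damped_integral f z0 u (Phi u)) /\
    U 0 /\ Phi 0 = v.

(* A cusp is [None] for i*oo, and [Some r] for a rational r. *)
Definition maps_infinity_to (g : mat2) (a : option R) : Prop :=
  match a with
  | None => m21 g = 0%Z
  | Some r => m21 g <> 0%Z /\ (r = IZR (m11 g) / IZR (m21 g))%R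
  end.

Definition is_reg_integral_to_cusp
    (f : C -> C) (z0 : C) (a : option R) (v : C) : Prop :=
  exists g : mat2, SL2Z g /\ maps_infinity_to g a /\
    is_reg_integral (slash 2 f g) (mobius (mat2_inv g) z0) v.

Definition is_reg_integral_between_cusps
    (f : C -> C) (a b : option R) (v : C) : Prop :=
  forall z0 : C, upper_half_plane z0 ->
    exists va vb : C,
      is_reg_integral_to_cusp f z0 a va /\
      is_reg_integral_to_cusp f z0 b vb /\
      v = vb - va.

Definition discriminant (D : Z) : Prop := (D mod 4 = 0 \/ D mod 4 = 1)%Z.

Definition is_square (D : Z) : Prop := exists m : Z, D = (m * m)%Z.

Record bqf : Type := Bqf { qa : Z; qb : Z; qc : Z }.

Definition bqf_disc (Q : bqf) : Z := (qb Q * qb Q - 4 * qa Q * qc Q)%Z.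

(* Q(z, 1) *)
Definition bqf_eval (Q : bqf) (z : C) : C :=
  ZtoC (qa Q) * z ^ 2 + ZtoC (qb Q) * z + ZtoC (qc Q).

Definition bqf_content (Q : bqf) : Z := Z.gcd (Z.gcd (qa Q) (qb Q)) (qc Q).

Definition bqf_primitive_part (Q : bqf) : bqf :=
  let g := bqf_content Q in Bqf (qa Q / g) (qb Q / g) (qc Q / g).

Definition S_set (Q : bqf) (z : C) : Prop :=
  upper_half_plane z /\
  (IZR (qa Q) * (Cmod z) ^ 2 + IZR (qb Q) * Re z + IZR (qc Q) = 0)%R.

(* For qa Q <> 0 and positive discriminant, the parametrization of S_Q by the
   angle in ]0, PI[. *)
Definition S_center (Q : bqf) : R := (- IZR (qb Q) / (2 * IZR (qa Q)))%R.
Definition S_radius (Q : bqf) : R :=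
  (sqrt (IZR (bqf_disc Q)) / (2 * Rabs (IZR (qa Q))))%R.
Definition S_point (Q : bqf) (theta : R) : C :=
  S_center Q + S_radius Q * Cexp (Ci * theta).

(* The integral of f over the directed arc of S_Q from z to z'. *)
Definition is_arc_integral (f : C -> C) (Q : bqf) (z z' v : C) : Prop :=
  exists theta theta' : R,
    (0 < theta < PI)%R /\ (0 < theta' < PI)%R /\
    S_point Q theta = z /\ S_point Q theta' = z' /\
    is_RInt (V := C_R_NormedModule)
      (fun s : R => f (S_point Q s) * (Ci * S_radius Q * Cexp (Ci * s)))
      theta theta' v.

(* Start and end of the directed S_Q.  If qa Q <> 0, the start is the larger root
   of Q(x, 1) when qa Q > 0 (counterclockwise) and the smaller one when qa Q < 0
   (clockwise); the same formula covers both cases. *)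
Definition S_start (Q : bqf) : option R :=
  Some (if (qa Q =? 0)%Z then - IZR (qc Q) / IZR (qb Q)
        else (- IZR (qb Q) + sqrt (IZR (bqf_disc Q))) / (2 * IZR (qa Q)))%R.
Definition S_end (Q : bqf) : option R :=
  if (qa Q =? 0)%Z then None
  else Some ((- IZR (qb Q) - sqrt (IZR (bqf_disc Q))) / (2 * IZR (qa Q)))%R.

Definition pell4_solution (D t u : Z) : Prop :=
  (0 < t /\ 0 < u /\ t * t - D * (u * u) = 4)%Z.

Definition pell4_smallest (D t u : Z) : Prop :=
  pell4_solution D t u /\
  forall t' u' : Z, pell4_solution D t' u' -> (t <= t' /\ u <= u')%Z.

(* The two halves are exact, since t and b u have the same parity when (t, u)
   solves t^2 - D u^2 = 4 for the discriminant D of Q. *)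
Definition automorph (Q : bqf) (t u : Z) : mat2 :=
  Mat2 ((t + qb Q * u) / 2) (qc Q * u) (- (qa Q * u)) ((t - qb Q * u) / 2).

Definition is_gQ (Q : bqf) (g : mat2) : Prop :=
  let Q0 := bqf_primitive_part Q in
  exists t u : Z, pell4_smallest (bqf_disc Q0) t u /\ g = automorph Q0 t u.

(* v is the value of C(F; Q), for F of weight 2k. *)
Definition is_cycle_integral (k : nat) (F : C -> C) (Q : bqf) (v : C) : Prop :=
  let f := fun z : C => F z * bqf_eval Q z ^ (k - 1) in
  (is_square (bqf_disc Q) ->
     is_reg_integral_between_cusps f (S_start Q) (S_end Q) v) /\
  (~ is_square (bqf_disc Q) ->
     forall g : mat2, is_gQ Q g ->
     forall z : C, S_set Q z -> is_arc_integral f Q z (mobius g z) v).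

(* Main.v *)
(* Put r = k - 1. With one second-order bracket per step, F_(j-1) =
   Q F_j'' - (2j - 1) Q' F_j' + j (2j - 1) Q'' F_j starting from F_r = G, one obtains
   E_Q = F_0 with E_Q' = Q^r G^(2r+1): the integrand of the cycle integral is exact.
   Each bracket is covariant under SL_2(Z), so the modularity of G gives
   E_Q(g z) = E_(Q o g)(z).

   If D is not a square, the integral is E_Q(g_Q z) - E_Q(z), which vanishes because
   Q o g_Q = Q. If D is a square, move a cusp of S_Q to infinity by g; then Q o g is
   linear, and along a vertical ray E_(Q o g) is, up to a constant kappa, a combination
   of s^j exp(l s) with l > 0 and of an exponentially decaying function (kappa is the
   constant term of G if k = 1, and 0 otherwise). Such functions have Laplace
   transforms that continue to u = 0, so an integration by parts gives the regularized
   integral kappa - E_(Q o g)(g^(-1) z0) = kappa - E_Q(z0). It is the same at both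
   cusps, and the difference is 0. *)

Require Import Defs.
From Stdlib Require Import Reals ZArith.
From Coquelicot Require Import Coquelicot.
From Stdlib Require Import Lra Lia.

Local Open Scope C_scope.

(** * Derivatives of complex functions and of curves *)

(** The bracket is dictated by Bol's identity: [F_j] has weight [-2j] and [F_j^(2j+1)] weight
    [2j + 2], so [Q F_j^(2j+1)] has weight [2j], the weight of the [(2j-1)]-st derivative of a
    function of weight [2 - 2j]. The bracket is that function, and [Q''' = 0] keeps it down to three
    terms. Iterating it avoids a closed formula for [E_Q], whose covariance would concern a long
    sum, whereas one step involves only two derivatives.

    In the square case the obstacle is the position of the poles. A term [s^j exp(l s)] has its pole
    at [u = l > 0], on the real axis between the half-plane of convergence and 0, so the
    continuation has to pass beside the axis. A constant term in the primitive would put a pole at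
    [u = 0] itself; subtracting [kappa] prevents this. The same [kappa] serves both cusps because
    [G], being modular, has the same q-expansion after either cusp has been moved to infinity. *)

Notation Cderive f z l := (is_derive (K := C_AbsRing) (V := C_NormedModule) f z l).
Notation curve_derive f s l := (is_derive (K := R_AbsRing) (V := C_R_NormedModule) f s l).

(* Complex derivatives ([e] the identity of C) and derivatives of curves
   ([e] the inclusion of R in C) at once. *)
Definition derive_rel {T : Type} (e : T -> C) (f : T -> C) (t : T) (l : C) : Prop :=
  forall eps : R, (0 < eps)%R -> exists delta : R, (0 < delta)%R /\
    forall t' : T, (Cmod (e t' - e t) < delta)%R ->
      (Cmod (f t' - f t - l * (e t' - e t)) <= eps * Cmod (e t' - e t))%R.

Lemma Cderive_rel (f : C -> C) (z l : C) :
  Cderive f z l <-> derive_rel (fun w => w) f z l.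
Proof.
  split.
  - intros [_ H] eps Heps.
    specialize (H z (fun P HP => HP) (mkposreal eps Heps)).
    destruct H as [d Hd]. exists d. split; [apply cond_pos|].
    intros w Hw. generalize (Hd w Hw). rewrite (Cmult_comm l). intros H; exact H.
  - intros H. split; [apply (@is_linear_scal_l C_AbsRing C_NormedModule)|].
    intros x Hx eps.
    assert (x = z) as ->.
    { symmetry. apply (is_filter_lim_locally_unique (V := AbsRing_NormedModule C_AbsRing)). exact Hx. }
    destruct (H eps (cond_pos eps)) as [d [Hd0 Hd]].
    exists (mkposreal d Hd0). intros w Hw. generalize (Hd w Hw).
    rewrite (Cmult_comm l). intros H1; exact H1.
Qed.

Lemma curve_derive_rel (f : R -> C) (s : R) (l : C) :
  curve_derive f s l <-> derive_rel RtoC f s l.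
Proof.
  assert (Hsc : forall r : R, scal (V := C_R_NormedModule) r l = l * RtoC r).
  { intros r. unfold scal; simpl. unfold prod_scal, scal; simpl. unfold mult; simpl.
    destruct l as [a b]. unfold Cmult, RtoC; simpl. f_equal; ring. }
  assert (Hn : forall x : C, norm (K := R_AbsRing) (V := C_R_NormedModule) x = Cmod x).
  { intros x. symmetry. apply Cmod_norm. }
  split.
  - intros [_ H] eps Heps.
    specialize (H s (fun P HP => HP) (mkposreal eps Heps)).
    destruct H as [d Hd]. exists d. split; [apply cond_pos|].
    intros t Ht. rewrite <- RtoC_minus in Ht |- *. rewrite Cmod_R in Ht |- *.
    generalize (Hd t Ht). rewrite Hn, Hsc. intros H1; exact H1.
  - intros H. split; [apply (@is_linear_scal_l R_AbsRing C_R_NormedModule)|].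
    intros x Hx eps.
    assert (x = s) as ->.
    { symmetry. apply (is_filter_lim_locally_unique (V := R_NormedModule)). exact Hx. }
    destruct (H eps (cond_pos eps)) as [d [Hd0 Hd]].
    exists (mkposreal d Hd0). intros t Ht.
    specialize (Hd t). rewrite <- RtoC_minus in Hd. rewrite Cmod_R in Hd.
    rewrite Hn, Hsc. apply Hd. exact Ht.
Qed.

Section DeriveRel.

Context {T : Type} (e : T -> C).

Lemma derive_rel_const (c : C) (t : T) : derive_rel e (fun _ => c) t 0.
Proof.
  intros eps Heps. exists 1%R. split; [lra|]. intros t' _.
  replace (c - c - 0 * (e t' - e t)) with (RtoC 0) by ring. rewrite Cmod_0.
  apply Rmult_le_pos; [lra|apply Cmod_ge_0].
Qed.

Lemma derive_rel_id (t : T) : derive_rel e e t 1.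
Proof.
  intros eps Heps. exists 1%R. split; [lra|]. intros t' _.
  replace (e t' - e t - 1 * (e t' - e t)) with (RtoC 0) by ring. rewrite Cmod_0.
  apply Rmult_le_pos; [lra|apply Cmod_ge_0].
Qed.

Lemma derive_rel_plus (f g : T -> C) (t : T) (a b : C) :
  derive_rel e f t a -> derive_rel e g t b ->
  derive_rel e (fun t' => f t' + g t') t (a + b).
Proof.
  intros Hf Hg eps Heps.
  destruct (Hf (eps / 2)%R) as [d1 [Hd1 H1]]; [lra|].
  destruct (Hg (eps / 2)%R) as [d2 [Hd2 H2]]; [lra|].
  exists (Rmin d1 d2). split; [apply Rmin_pos; assumption|].
  intros t' Ht.
  specialize (H1 t' (Rlt_le_trans _ _ _ Ht (Rmin_l _ _))).
  specialize (H2 t' (Rlt_le_trans _ _ _ Ht (Rmin_r _ _))).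
  replace (f t' + g t' - (f t + g t) - (a + b) * (e t' - e t))
    with ((f t' - f t - a * (e t' - e t)) + (g t' - g t - b * (e t' - e t))) by ring.
  eapply Rle_trans; [apply Cmod_triangle|]. lra.
Qed.

Lemma derive_rel_lipschitz (f : T -> C) (t : T) (a : C) :
  derive_rel e f t a -> exists delta : R, (0 < delta)%R /\
    forall t', (Cmod (e t' - e t) < delta)%R ->
      (Cmod (f t' - f t) <= (Cmod a + 1) * Cmod (e t' - e t))%R.
Proof.
  intros Hf. destruct (Hf 1%R) as [d [Hd H]]; [lra|].
  exists d. split; [exact Hd|]. intros t' Ht. specialize (H t' Ht).
  replace (f t' - f t) with ((f t' - f t - a * (e t' - e t)) + a * (e t' - e t)) by ring.
  eapply Rle_trans; [apply Cmod_triangle|]. rewrite Cmod_mult. lra.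
Qed.

Lemma derive_rel_comp (h : C -> C) (f : T -> C) (t : T) (a b : C) :
  derive_rel (fun w => w) h (f t) b -> derive_rel e f t a ->
  derive_rel e (fun t' => h (f t')) t (b * a).
Proof.
  intros Hh Hf eps Heps.
  destruct (derive_rel_lipschitz f t a Hf) as [d0 [Hd0 H0]].
  pose proof (Cmod_ge_0 a) as Ha. pose proof (Cmod_ge_0 b) as Hb.
  destruct (Hf (eps / (2 * (Cmod b + 1)))%R) as [d1 [Hd1 H1]].
  { apply Rdiv_lt_0_compat; lra. }
  destruct (Hh (eps / (2 * (Cmod a + 1)))%R) as [d2 [Hd2 H2]].
  { apply Rdiv_lt_0_compat; lra. }
  exists (Rmin (Rmin d0 d1) (d2 / (Cmod a + 1))). split.
  { apply Rmin_pos; [apply Rmin_pos; assumption|]. apply Rdiv_lt_0_compat; lra. }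
  intros t' Ht.
  pose proof (Rmin_l (Rmin d0 d1) (d2 / (Cmod a + 1))).
  pose proof (Rmin_r (Rmin d0 d1) (d2 / (Cmod a + 1))).
  pose proof (Rmin_l d0 d1). pose proof (Rmin_r d0 d1).
  specialize (H0 t' ltac:(lra)). specialize (H1 t' ltac:(lra)).
  set (r := Cmod (e t' - e t)) in *.
  assert (Hr : (0 <= r)%R) by apply Cmod_ge_0.
  assert (Hs : (Cmod (f t' - f t) < d2)%R).
  { eapply Rle_lt_trans; [exact H0|].
    replace d2 with ((Cmod a + 1) * (d2 / (Cmod a + 1)))%R by (field; lra).
    apply Rmult_lt_compat_l; lra. }
  specialize (H2 (f t') Hs).
  replace (h (f t') - h (f t) - b * a * (e t' - e t))
    with ((h (f t') - h (f t) - b * (f t' - f t)) + b * (f t' - f t - a * (e t' - e t))) by ring.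
  eapply Rle_trans; [apply Cmod_triangle|]. rewrite Cmod_mult.
  assert (A1 : (eps / (2 * (Cmod a + 1)) * Cmod (f t' - f t) <= eps / 2 * r)%R).
  { replace (eps / 2 * r)%R with (eps / (2 * (Cmod a + 1)) * ((Cmod a + 1) * r))%R by (field; lra).
    apply Rmult_le_compat_l; [|exact H0]. apply Rlt_le, Rdiv_lt_0_compat; lra. }
  assert (A2 : (Cmod b * Cmod (f t' - f t - a * (e t' - e t)) <= eps / 2 * r)%R).
  { replace (eps / 2 * r)%R with ((Cmod b + 1) * (eps / (2 * (Cmod b + 1)) * r))%R by (field; lra).
    apply Rmult_le_compat; try apply Cmod_ge_0; [lra|exact H1]. }
  lra.
Qed.

Lemma derive_rel_scal (c : C) (f : T -> C) (t : T) (a : C) :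
  derive_rel e f t a -> derive_rel e (fun t' => c * f t') t (c * a).
Proof.
  intros Hf. apply (derive_rel_comp (fun w => c * w) f t a c); [|exact Hf].
  intros eps Heps. exists 1%R. split; [lra|]. intros w _.
  replace (c * w - c * f t - c * (w - f t)) with (RtoC 0) by ring. rewrite Cmod_0.
  apply Rmult_le_pos; [lra|apply Cmod_ge_0].
Qed.

Lemma derive_rel_linear (c : C) (t : T) : derive_rel e (fun t' => c * e t') t c.
Proof.
  intros eps Heps. exists 1%R. split; [lra|]. intros t' _.
  replace (c * e t' - c * e t - c * (e t' - e t)) with (RtoC 0) by ring. rewrite Cmod_0.
  apply Rmult_le_pos; [lra|apply Cmod_ge_0].
Qed.

Lemma derive_rel_square (f : T -> C) (t : T) (a : C) :
  derive_rel e f t a -> derive_rel e (fun t' => f t' * f t') t (2 * f t * a).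
Proof.
  intros Hf. apply (derive_rel_comp (fun w => w * w) f t a (2 * f t)); [|exact Hf].
  intros eps Heps. exists eps. split; [lra|]. intros w Hw.
  replace (w * w - f t * f t - 2 * f t * (w - f t)) with ((w - f t) * (w - f t)) by ring.
  rewrite Cmod_mult. apply Rmult_le_compat_r; [apply Cmod_ge_0|lra].
Qed.

Lemma derive_rel_ext (f g : T -> C) (t : T) (a : C) :
  (forall t', f t' = g t') -> derive_rel e f t a -> derive_rel e g t a.
Proof.
  intros E H eps Heps. destruct (H eps Heps) as [d [Hd H']].
  exists d. split; [exact Hd|]. intros t' Ht. rewrite <- !E. auto.
Qed.

(* Polarization: the product rule follows from the rule for squares. *)
Lemma derive_rel_mult (f g : T -> C) (t : T) (a b : C) :
  derive_rel e f t a -> derive_rel e g t b ->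
  derive_rel e (fun t' => f t' * g t') t (a * g t + f t * b).
Proof.
  intros Hf Hg.
  assert (H2 : RtoC 2 <> 0) by (intros H; apply RtoC_inj in H; lra).
  assert (E : a * g t + f t * b
    = / 2 * (2 * (f t + g t) * (a + b) + - (1) * (2 * f t * a + 2 * g t * b))) by (field; auto).
  rewrite E.
  apply derive_rel_ext with (fun t' => / 2 * ((f t' + g t') * (f t' + g t')
     + - (1) * (f t' * f t' + g t' * g t'))).
  { intros t'. field; auto. }
  apply derive_rel_scal, derive_rel_plus.
  - apply (derive_rel_square (fun t' => f t' + g t')). now apply derive_rel_plus.
  - apply derive_rel_scal, derive_rel_plus; now apply derive_rel_square.
Qed.

Lemma derive_rel_inv (f : T -> C) (t : T) (a : C) :
  f t <> 0 -> derive_rel e f t a ->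
  derive_rel e (fun t' => / f t') t (- a / (f t * f t)).
Proof.
  intros Hz Hf. set (z := f t) in *.
  replace (- a / (z * z)) with (- / (z * z) * a) by (field; auto).
  apply (derive_rel_comp (fun w => / w) f t a); [|exact Hf]. fold z.
  pose proof (proj1 (Cmod_gt_0 z) Hz) as Hm. set (m := Cmod z) in *.
  (* The error is [(w - z)^2 / (w z^2)]. Radius [m / 2] forces [|w| > m / 2], so the denominator
     exceeds [m^3 / 2], and [|w - z| < eps m^3 / 2] leaves a factor at most [eps]. *)
  intros eps Heps. exists (Rmin (m / 2) (eps * m * m * m / 2)). split.
  { apply Rmin_pos; [lra|]. apply Rdiv_lt_0_compat; [|lra].
    repeat apply Rmult_lt_0_compat; assumption. }
  intros w Hw.
  pose proof (Rmin_l (m / 2) (eps * m * m * m / 2)).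
  pose proof (Rmin_r (m / 2) (eps * m * m * m / 2)).
  assert (Hwm : (m / 2 < Cmod w)%R).
  { assert (m <= Cmod (w - z) + Cmod w)%R.
    { unfold m. replace z with (- (w - z) + w) at 1 by ring.
      rewrite <- (Cmod_opp (w - z)). apply Cmod_triangle. }
    lra. }
  assert (Hw0 : w <> 0) by (apply Cmod_gt_0; lra).
  replace (/ w - / z - - / (z * z) * (w - z)) with ((w - z) / (w * z * z) * (w - z))
    by (field; auto).
  rewrite Cmod_mult, Cmod_div by (repeat apply Cmult_neq_0; auto). rewrite !Cmod_mult. fold m.
  apply Rmult_le_compat_r; [apply Cmod_ge_0|].
  apply Rmult_le_reg_r with (Cmod w * m * m)%R; [repeat apply Rmult_lt_0_compat; lra|].
  unfold Rdiv. rewrite Rmult_assoc, Rinv_l by (apply Rgt_not_eq; repeat apply Rmult_lt_0_compat; lra).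
  rewrite Rmult_1_r. apply Rle_trans with (eps * m * m * m / 2)%R; [lra|].
  replace (eps * m * m * m / 2)%R with (eps * ((m / 2) * m * m))%R by field.
  apply Rmult_le_compat_l; [lra|]. apply Rmult_le_compat_r; [lra|].
  apply Rmult_le_compat_r; lra.
Qed.

End DeriveRel.

Lemma derive_rel_unique (f : C -> C) (z a b : C) :
  derive_rel (fun w => w) f z a -> derive_rel (fun w => w) f z b -> a = b.
Proof.
  intros Ha Hb. apply Cderive_rel in Ha, Hb.
  rewrite <- (is_C_derive_unique _ _ _ Ha). now apply is_C_derive_unique.
Qed.

Lemma derive_rel_ext_loc (f g : C -> C) (z a : C) (d : R) :
  (0 < d)%R -> (forall w, (Cmod (w - z) < d)%R -> f w = g w) ->
  derive_rel (fun w => w) f z a -> derive_rel (fun w => w) g z a.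
Proof.
  intros Hd E H eps Heps. destruct (H eps Heps) as [d' [Hd' H']].
  exists (Rmin d d'). split; [now apply Rmin_pos|]. intros w Hw.
  pose proof (Rmin_l d d'). pose proof (Rmin_r d d').
  rewrite <- !E; [apply H'; lra| |lra].
  replace (z - z) with (RtoC 0) by ring. now rewrite Cmod_0.
Qed.

Lemma im_le_Cmod (z : C) : (Rabs (Im z) <= Cmod z)%R.
Proof. eapply Rle_trans; [apply Rmax_r|apply Rmax_Cmod]. Qed.

(** The disc of radius [Im z] about [z] lies in the half-plane, so values elsewhere do not affect a
    derivative at [z]. *)
Lemma derive_rel_ext_H (f g : C -> C) (z a : C) :
  upper_half_plane z -> (forall w, upper_half_plane w -> f w = g w) ->
  derive_rel (fun w => w) f z a -> derive_rel (fun w => w) g z a.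
Proof.
  intros Hz E. apply derive_rel_ext_loc with (Im z); [exact Hz|].
  intros w Hw. apply E. unfold upper_half_plane.
  pose proof (im_le_Cmod (w - z)) as H. destruct w as [x y], z as [x' y']. simpl in *.
  apply Rabs_le_between in H. unfold upper_half_plane in Hz. simpl in Hz. lra.
Qed.

(** * The covariant primitive *)

Lemma ZtoC_plus (m n : Z) : ZtoC (m + n) = ZtoC m + ZtoC n.
Proof. unfold ZtoC. now rewrite plus_IZR, RtoC_plus. Qed.

Lemma ZtoC_mult (m n : Z) : ZtoC (m * n) = ZtoC m * ZtoC n.
Proof. unfold ZtoC. now rewrite mult_IZR, RtoC_mult. Qed.

Lemma ZtoC_opp (m : Z) : ZtoC (- m) = - ZtoC m.
Proof. unfold ZtoC. now rewrite opp_IZR, RtoC_opp. Qed.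

Lemma ZtoC_sub (m n : Z) : ZtoC (m - n) = ZtoC m - ZtoC n.
Proof. unfold ZtoC. now rewrite minus_IZR, RtoC_minus. Qed.

(** * Moebius transformations and automorphy factors *)

Definition automorphy (g : mat2) (z : C) : C := ZtoC (m21 g) * z + ZtoC (m22 g).

Lemma automorphy_Im (g : mat2) (z : C) :
  Im (automorphy g z) = (IZR (m21 g) * Im z)%R.
Proof. destruct z as [x y]. unfold automorphy, ZtoC. simpl. ring. Qed.

Lemma automorphy_Re (g : mat2) (z : C) :
  Re (automorphy g z) = (IZR (m21 g) * Re z + IZR (m22 g))%R.
Proof. destruct z as [x y]. unfold automorphy, ZtoC. simpl. ring. Qed.

Lemma SL2Z_real (g : mat2) : SL2Z g ->
  (IZR (m11 g) * IZR (m22 g) - IZR (m12 g) * IZR (m21 g) = 1)%R.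
Proof. intros H. rewrite <- !mult_IZR, <- minus_IZR. now rewrite H. Qed.

Lemma automorphy_neq_0 (g : mat2) (z : C) :
  SL2Z g -> upper_half_plane z -> automorphy g z <> 0.
Proof.
  intros Hg Hz H. unfold upper_half_plane in Hz.
  pose proof (automorphy_Im g z) as HI. pose proof (automorphy_Re g z) as HR.
  rewrite H in HI, HR. simpl in HI, HR.
  symmetry in HI. apply Rmult_integral in HI. destruct HI as [HI|HI]; [|lra].
  pose proof (SL2Z_real g Hg) as Hd. rewrite HI in Hd, HR.
  assert (IZR (m22 g) = 0)%R by lra. rewrite H0 in Hd. lra.
Qed.

Lemma mobius_alt (g : mat2) (z : C) :
  mobius g z = (ZtoC (m11 g) * z + ZtoC (m12 g)) / automorphy g z.
Proof. reflexivity. Qed.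

Lemma Cmod_sqr (z : C) : (Cmod z ^ 2 = Re z * Re z + Im z * Im z)%R.
Proof. rewrite Cmod2_alt. ring. Qed.

Lemma mobius_Im (g : mat2) (z : C) : SL2Z g -> automorphy g z <> 0 ->
  Im (mobius g z) = (Im z / Cmod (automorphy g z) ^ 2)%R.
Proof.
  intros Hg HJ.
  assert (HJ' : (0 < Cmod (automorphy g z) ^ 2)%R).
  { apply pow_lt. now apply Cmod_gt_0. }
  rewrite mobius_alt. pose proof (SL2Z_real g Hg) as Hd.
  pose proof (automorphy_Im g z) as HI. pose proof (automorphy_Re g z) as HR.
  rewrite Cmod_sqr in *. destruct (automorphy g z) as [u v].
  destruct z as [x y]. unfold ZtoC. simpl in *. subst u v.
  set (a := IZR (m11 g)) in *. set (b := IZR (m12 g)) in *.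
  set (c := IZR (m21 g)) in *. set (d := IZR (m22 g)) in *.
  transitivity (y * (a * d - b * c) / ((c * x + d) * (c * x + d) + c * y * (c * y)))%R.
  - field. lra.
  - rewrite Hd. field. lra.
Qed.

Lemma mobius_H (g : mat2) (z : C) :
  SL2Z g -> upper_half_plane z -> upper_half_plane (mobius g z).
Proof.
  intros Hg Hz. pose proof (automorphy_neq_0 g z Hg Hz) as HJ.
  unfold upper_half_plane. rewrite mobius_Im by assumption.
  apply Rdiv_lt_0_compat; [exact Hz|]. apply pow_lt. now apply Cmod_gt_0.
Qed.

Lemma SL2Z_complex (g : mat2) : SL2Z g ->
  ZtoC (m11 g) * ZtoC (m22 g) - ZtoC (m12 g) * ZtoC (m21 g) = 1.
Proof. intros H. rewrite <- !ZtoC_mult, <- ZtoC_sub. unfold SL2Z in H. now rewrite H. Qed.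

Lemma SL2Z_inv (g : mat2) : SL2Z g -> SL2Z (mat2_inv g).
Proof. unfold SL2Z, mat2_inv. simpl. lia. Qed.

Lemma mobius_inv (g : mat2) (z : C) : SL2Z g -> upper_half_plane z ->
  mobius g (mobius (mat2_inv g) z) = z.
Proof.
  intros Hg Hz.
  pose proof (automorphy_neq_0 _ z (SL2Z_inv g Hg) Hz) as HJ.
  pose proof (automorphy_neq_0 g _ Hg (mobius_H _ z (SL2Z_inv g Hg) Hz)) as HJ'.
  pose proof (SL2Z_complex g Hg) as Hd.
  unfold automorphy in *. unfold mobius in *. simpl in *. rewrite !ZtoC_opp in *.
  set (a := ZtoC (m11 g)) in *. set (b := ZtoC (m12 g)) in *.
  set (c := ZtoC (m21 g)) in *. set (d := ZtoC (m22 g)) in *.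
  assert (E1 : a * ((d * z + - b) / (- c * z + a)) + b = z / (- c * z + a)).
  { transitivity ((a * d - b * c) * z / (- c * z + a)); [field; exact HJ|].
    rewrite Hd. field. exact HJ. }
  assert (E2 : c * ((d * z + - b) / (- c * z + a)) + d = 1 / (- c * z + a)).
  { replace (RtoC 1) with (a * d - b * c) by exact Hd. field. exact HJ. }
  rewrite E1, E2. field. exact HJ.
Qed.

Lemma mobius_derive (g : mat2) (z : C) : SL2Z g -> upper_half_plane z ->
  derive_rel (fun w => w) (mobius g) z (1 / (automorphy g z * automorphy g z)).
Proof.
  intros Hg Hz. pose proof (automorphy_neq_0 g z Hg Hz) as HJ.
  pose proof (SL2Z_complex g Hg) as Hd.
  assert (Haff : forall a b : C, derive_rel (fun w => w) (fun w => a * w + b) z (a * 1 + 0)).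
  { intros a b. apply derive_rel_plus; [|apply derive_rel_const].
    apply derive_rel_scal, derive_rel_id. }
  replace (1 / (automorphy g z * automorphy g z)) with
    ((ZtoC (m11 g) * 1 + 0) * / automorphy g z
     + (ZtoC (m11 g) * z + ZtoC (m12 g))
       * (- (ZtoC (m21 g) * 1 + 0) / (automorphy g z * automorphy g z))).
  - apply (derive_rel_mult (fun w => w) (fun w => ZtoC (m11 g) * w + ZtoC (m12 g))
      (fun w => / automorphy g w)); [apply Haff|].
    apply derive_rel_inv; [exact HJ|]. apply Haff.
  - transitivity ((ZtoC (m11 g) * ZtoC (m22 g) - ZtoC (m12 g) * ZtoC (m21 g))
      / (automorphy g z * automorphy g z)); [|now rewrite Hd].
    unfold automorphy in *. field. exact HJ.
Qed.

(** Writing the exponent [n - 1] as a division by [f t] avoids truncated subtraction and suits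
    [field]; the powers differentiated below are those of the nowhere vanishing automorphy
    factor. *)
Lemma derive_rel_pow {T : Type} (e f : T -> C) (t : T) (a : C) (n : nat) :
  f t <> 0 -> derive_rel e f t a ->
  derive_rel e (fun t' => f t' ^ n) t (INR n * f t ^ n / f t * a).
Proof.
  intros H0 Hf. induction n as [|n IH].
  - replace (INR 0 * f t ^ 0 / f t * a) with (RtoC 0) by (simpl; field; exact H0).
    exact (derive_rel_const e 1 t).
  - replace (INR (S n) * f t ^ S n / f t * a)
      with (a * f t ^ n + f t * (INR n * f t ^ n / f t * a)).
    + apply (derive_rel_mult e f (fun t' => f t' ^ n)); assumption.
    + rewrite S_INR, RtoC_plus, Cpow_S. field. exact H0.
Qed.

(** * Quadratic forms and the iterated bracket *)

Definition bqf_diff (Q : bqf) (z : C) : C := 2 * ZtoC (qa Q) * z + ZtoC (qb Q).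

Lemma bqf_eval_derive (Q : bqf) (z : C) :
  derive_rel (fun w => w) (bqf_eval Q) z (bqf_diff Q z).
Proof.
  apply derive_rel_ext with (fun w => ZtoC (qa Q) * (w * w) + ZtoC (qb Q) * w + ZtoC (qc Q)).
  { intros w. unfold bqf_eval. ring. }
  replace (bqf_diff Q z) with (ZtoC (qa Q) * (2 * z * 1) + ZtoC (qb Q) * 1 + 0)
    by (unfold bqf_diff; ring).
  repeat apply derive_rel_plus; try apply derive_rel_const; apply derive_rel_scal.
  - apply (derive_rel_square (fun w => w) (fun w => w)), derive_rel_id.
  - apply derive_rel_id.
Qed.

Lemma bqf_diff_derive (Q : bqf) (z : C) :
  derive_rel (fun w => w) (bqf_diff Q) z (2 * ZtoC (qa Q)).
Proof.
  replace (2 * ZtoC (qa Q)) with (2 * ZtoC (qa Q) * 1 + 0) by ring.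
  apply derive_rel_plus; [|apply derive_rel_const]. apply derive_rel_scal, derive_rel_id.
Qed.

(** The form [Q(pX + qY, rX + sY)]: a right action on forms. *)
Definition bqf_comp (Q : bqf) (g : mat2) : bqf :=
  let (a, b, c) := Q in
  let (p, q, r, s) := g in
  Bqf (a * p * p + b * p * r + c * r * r)
      (2 * a * p * q + b * (p * s + q * r) + 2 * c * r * s)
      (a * q * q + b * q * s + c * s * s).

Lemma bqf_eval_mobius (Q : bqf) (g : mat2) (z : C) : automorphy g z <> 0 ->
  bqf_eval Q (mobius g z) = bqf_eval (bqf_comp Q g) z / (automorphy g z * automorphy g z).
Proof.
  intros HJ. rewrite mobius_alt. unfold automorphy in *. unfold bqf_eval.
  destruct Q as [a b c], g as [p q r s]. cbn [bqf_comp qa qb qc m11 m12 m21 m22] in *.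
  repeat rewrite ?ZtoC_plus, ?ZtoC_mult. change (ZtoC 2) with (RtoC 2). field. exact HJ.
Qed.

(** Carrying all derivatives as one sequence lets a bracket return an object of the same kind, so
    that brackets can be iterated without a new differentiability proof at each step. *)
Definition jet (g : nat -> C -> C) : Prop :=
  forall (i : nat) (z : C), upper_half_plane z ->
    derive_rel (fun w => w) (g i) z (g (S i) z).

(* The i-th derivative of Q g'' - (2r + 1) Q' g' + (r + 1)(2r + 1) Q'' g, the second
   Rankin-Cohen bracket of Q and g in weights -2 and -2r - 2. *)
Definition jet_step (Q : bqf) (r : nat) (g : nat -> C -> C) (i : nat) (z : C) : C :=
  bqf_eval Q z * g (S (S i)) z
  + (INR i - (2 * INR r + 1)) * bqf_diff Q z * g (S i) z
  + (INR i * (INR i - 1) - 2 * INR i * (2 * INR r + 1)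
     + 2 * (INR r + 1) * (2 * INR r + 1)) * ZtoC (qa Q) * g i z.

Lemma jet_step_jet (Q : bqf) (r : nat) (g : nat -> C -> C) :
  jet g -> jet (jet_step Q r g).
Proof.
  intros Hg i z Hz. unfold jet_step at 1.
  set (c1 := INR i - (2 * INR r + 1)).
  set (c2 := INR i * (INR i - 1) - 2 * INR i * (2 * INR r + 1)
     + 2 * (INR r + 1) * (2 * INR r + 1)).
  replace (jet_step Q r g (S i) z) with
    ((bqf_diff Q z * g (S (S i)) z + bqf_eval Q z * g (S (S (S i))) z)
     + ((c1 * (2 * ZtoC (qa Q))) * g (S i) z + (c1 * bqf_diff Q z) * g (S (S i)) z)
     + (c2 * ZtoC (qa Q)) * g (S i) z).
  - apply derive_rel_plus; [apply derive_rel_plus|].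
    + apply derive_rel_mult; [apply bqf_eval_derive|now apply Hg].
    + apply (derive_rel_mult _ (fun w => c1 * bqf_diff Q w)); [|now apply Hg].
      apply derive_rel_scal, bqf_diff_derive.
    + apply derive_rel_scal. now apply Hg.
  - unfold jet_step, c1, c2. rewrite S_INR, RtoC_plus. ring.
Qed.

(** The step with parameter [r'] raises the weight from [-2r' - 2] to [-2r']; after [r] steps a
    function of weight [-2r] has reached weight 0. *)
Fixpoint primitive (Q : bqf) (r : nat) (g : nat -> C -> C) : C -> C :=
  match r with
  | O => g O
  | S r' => primitive Q r' (jet_step Q r' g)
  end.

(** At order [i = 2r + 1] the two lower coefficients of [jet_step] vanish. One bracket thus trades
    [Q^r] times its own derivative of order [2r + 1] for [Q^(r+1)] times the derivative of [g] of
    order [2r + 3]. *)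
Lemma primitive_derive (Q : bqf) (r : nat) (g : nat -> C -> C) (z : C) :
  jet g -> upper_half_plane z ->
  derive_rel (fun w => w) (primitive Q r g) z (bqf_eval Q z ^ r * g (2 * r + 1)%nat z).
Proof.
  revert g. induction r as [|r IH]; intros g Hg Hz.
  - simpl. rewrite Cmult_1_l. now apply Hg.
  - simpl primitive. specialize (IH _ (jet_step_jet Q r g Hg) Hz).
    replace (bqf_eval Q z ^ S r * g (2 * S r + 1)%nat z)
      with (bqf_eval Q z ^ r * jet_step Q r g (2 * r + 1)%nat z); [exact IH|].
    replace (2 * S r + 1)%nat with (S (S (2 * r + 1))) by lia.
    unfold jet_step. rewrite Cpow_S.
    replace (RtoC (INR (2 * r + 1))) with (2 * INR r + 1)
      by (rewrite plus_INR, mult_INR; simpl; rewrite RtoC_plus, RtoC_mult; reflexivity).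
    ring.
Qed.

(* The induction step is the covariance of the Rankin-Cohen bracket. *)
Lemma primitive_mobius (Q : bqf) (s : mat2) (r : nat) (g h : nat -> C -> C) :
  SL2Z s -> jet g -> jet h ->
  (forall z, upper_half_plane z ->
     h O z = automorphy s z ^ (2 * r) * g O (mobius s z)) ->
  forall z, upper_half_plane z ->
    primitive Q r g (mobius s z) = primitive (bqf_comp Q s) r h z.
Proof.
  intros Hs. revert g h. induction r as [|r IH]; intros g h Hg Hh E z Hz.
  - simpl. rewrite E by exact Hz. simpl. ring.
  (* The induction hypothesis asks for a relation in order 0 only, here between the two brackets.
     The brackets involve two derivatives of [h], which [E1] and [E2] obtain by differentiating [E]
     and using uniqueness of derivatives. *)
  - simpl primitive. apply IH; [now apply jet_step_jet|now apply jet_step_jet| |exact Hz].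
    clear z Hz.
    assert (Hgs : forall i w, upper_half_plane w ->
      derive_rel (fun w => w) (fun w => g i (mobius s w)) w
        (g (S i) (mobius s w) * (1 / (automorphy s w * automorphy s w)))).
    { intros i w Hw. apply (derive_rel_comp (fun w => w) (g i) (mobius s)).
      - apply Hg. now apply mobius_H.
      - now apply mobius_derive. }
    set (n := RtoC (INR r)).
    assert (Hn : forall m : nat, RtoC (INR (2 * m)) = 2 * INR m).
    { intros m. now rewrite mult_INR, RtoC_mult. }
    set (c := ZtoC (m21 s)).
    assert (HJd : forall w, derive_rel (fun w => w) (automorphy s) w c).
    { intros w. replace c with (c * 1 + 0) by ring.
      apply derive_rel_plus; [|apply derive_rel_const]. apply derive_rel_scal, derive_rel_id. }
    assert (E1 : forall w, upper_half_plane w ->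
      h 1%nat w = automorphy s w ^ (2 * r) *
        ((2 * n + 2) * c * automorphy s w * g O (mobius s w) + g 1%nat (mobius s w))).
    { intros w Hw. pose proof (automorphy_neq_0 s w Hs Hw) as HJ.
      apply (derive_rel_unique (h O) w); [now apply Hh|].
      apply (derive_rel_ext_H (fun w => automorphy s w ^ (2 * S r) * g O (mobius s w)));
        [exact Hw|intros; symmetry; now apply E|].
      eapply eq_ind; [apply derive_rel_mult; [apply derive_rel_pow; [exact HJ|apply HJd]|now apply Hgs]|].
      simpl (g _). rewrite Hn, S_INR, RtoC_plus. fold n.
      replace (2 * S r)%nat with (S (S (2 * r))) by lia. rewrite !Cpow_S. field. exact HJ. }
    assert (E2 : forall w, upper_half_plane w ->
      h 2%nat w = automorphy s w ^ (2 * r) *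
        ((2 * n + 2) * (2 * n + 1) * c * c * g O (mobius s w)
         + (4 * n + 2) * c * g 1%nat (mobius s w) / automorphy s w
         + g 2%nat (mobius s w) / (automorphy s w * automorphy s w))).
    { intros w Hw. pose proof (automorphy_neq_0 s w Hs Hw) as HJ.
      apply (derive_rel_unique (h 1%nat) w); [now apply Hh|].
      apply (derive_rel_ext_H (fun w => automorphy s w ^ (2 * r) *
        ((2 * n + 2) * c * automorphy s w * g O (mobius s w) + g 1%nat (mobius s w))));
        [exact Hw|intros; symmetry; now apply E1|].
      eapply eq_ind; [apply derive_rel_mult; [apply derive_rel_pow; [exact HJ|apply HJd]|]|].
      - apply derive_rel_plus; [|now apply Hgs].
        apply (derive_rel_mult _ (fun w => (2 * n + 2) * c * automorphy s w)); [|now apply Hgs].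
        apply derive_rel_scal, HJd.
      - simpl (g _). rewrite Hn. fold n. field. exact HJ. }
    intros z Hz. pose proof (automorphy_neq_0 s z Hs Hz) as HJ.
    unfold jet_step. rewrite E2, E1, E by exact Hz.
    rewrite bqf_eval_mobius by exact HJ.
    replace (2 * S r)%nat with (S (S (2 * r))) by lia. rewrite !Cpow_S. simpl INR.
    fold n. set (P := automorphy s z ^ (2 * r)). clearbody P.
    (* Eliminate p, q, d in favour of J = c z + d and w = (p z + q) / J, which
       absorbs the relation p d - q c = 1. *)
    assert (Hw : ZtoC (m11 s) * z + ZtoC (m12 s) = mobius s z * automorphy s z)
      by (rewrite mobius_alt; field; exact HJ).
    assert (Hd : ZtoC (m22 s) = automorphy s z - c * z) by (unfold automorphy; fold c; ring).
    pose proof (SL2Z_complex s Hs) as Hdet. fold c in Hdet.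
    assert (Hq : ZtoC (m12 s) = mobius s z * automorphy s z - ZtoC (m11 s) * z)
      by (rewrite <- Hw; ring).
    assert (Hp : ZtoC (m11 s) = 1 / automorphy s z + mobius s z * c).
    { rewrite Hd, Hq in Hdet.
      replace (1 / automorphy s z) with
       ((ZtoC (m11 s) * (automorphy s z - c * z)
        - (mobius s z * automorphy s z - ZtoC (m11 s) * z) * c) / automorphy s z)
       by (now rewrite Hdet).
      field. exact HJ. }
    rewrite Hp in Hq. clear Hw Hdet.
    generalize (g O (mobius s z)) (g 1%nat (mobius s z)) (g 2%nat (mobius s z)).
    intros G0 G1 G2.
    generalize dependent (mobius s z). intros w Hp Hq.
    generalize dependent (automorphy s z). intros J HJ Hd Hq Hp.
    destruct s as [p q c' d], Q as [a b c'']. unfold bqf_eval, bqf_diff.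
    cbn [bqf_comp qa qb qc m11 m12 m21 m22] in *.
    repeat rewrite ?ZtoC_plus, ?ZtoC_mult. change (ZtoC 2) with (RtoC 2).
    rewrite Hq, Hp, Hd. fold c. field. exact HJ.
Qed.

(** * Geodesic arcs *)

Lemma automorph_halves (Q : bqf) (t u : Z) :
  (t * t - bqf_disc Q * (u * u) = 4)%Z ->
  (t + qb Q * u = 2 * ((t + qb Q * u) / 2) /\ t - qb Q * u = 2 * ((t - qb Q * u) / 2))%Z.
Proof.
  unfold bqf_disc. intros H.
  assert (He : exists m, (t + qb Q * u = 2 * m)%Z).
  { destruct (Z.Even_or_Odd (t + qb Q * u)) as [[m Hm]|[m Hm]]; [now exists m|].
    (* With [t + b u = 2m + 1] the equation reads [(2m + 1)(2m + 1 - 2bu) + 4acu^2 = 4], whose left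
       side is odd. *)
    exfalso. assert (t = 2 * m + 1 - qb Q * u)%Z as -> by lia. ring_simplify in H.
    set (A := (m * qb Q * u)%Z) in *. set (B := (u ^ 2 * qa Q * qc Q)%Z) in *.
    set (X := (qb Q * u)%Z) in *. lia. }
  destruct He as [m Hm].
  assert (Hm' : (t - qb Q * u = 2 * (m - qb Q * u))%Z) by lia.
  rewrite Hm, Hm'. rewrite !(Z.mul_comm 2), !Z.div_mul by lia. lia.
Qed.

(** For the diagonal entries [p], [s] one has [p - s = b0 u], and the Pell equation becomes
    [p s + a0 c0 u^2 = 1], the determinant. Each coefficient of [Q o g] is the old one times this
    determinant, modulo [p - s - b0 u]. The content [n] factors out because the action is linear in
    the form. *)
Lemma is_gQ_automorphism (Q : bqf) (g : mat2) :
  (0 < bqf_disc Q)%Z -> is_gQ Q g -> SL2Z g /\ bqf_comp Q g = Q.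
Proof.
  intros HD (t & u & [[Ht [Hu H4]] _] & ->).
  set (n := bqf_content Q).
  assert (Hn : (n <> 0)%Z).
  { unfold n, bqf_content. intros H0. apply Z.gcd_eq_0 in H0. destruct H0 as [H0 Hc].
    apply Z.gcd_eq_0 in H0. destruct H0 as [Ha Hb].
    unfold bqf_disc in HD. rewrite Ha, Hb, Hc in HD. lia. }
  assert (Hdiv : forall m, (n | m)%Z -> m = (n * (m / n))%Z).
  { intros m [j ->]. rewrite Z.div_mul by exact Hn. ring. }
  assert (Ha : qa Q = (n * qa (bqf_primitive_part Q))%Z).
  { apply Hdiv. unfold n, bqf_content. etransitivity; apply Z.gcd_divide_l. }
  assert (Hb : qb Q = (n * qb (bqf_primitive_part Q))%Z).
  { apply Hdiv. unfold n, bqf_content.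
    etransitivity; [apply Z.gcd_divide_l|apply Z.gcd_divide_r]. }
  assert (Hc : qc Q = (n * qc (bqf_primitive_part Q))%Z).
  { apply Hdiv. unfold n, bqf_content. apply Z.gcd_divide_r. }
  destruct (automorph_halves _ _ _ H4) as [Hp Hs].
  destruct Q as [a b c]. cbn [qa qb qc] in Ha, Hb, Hc.
  set (Q0 := bqf_primitive_part {| qa := a; qb := b; qc := c |}) in *.
  unfold automorph, SL2Z. destruct Q0 as [a0 b0 c0].
  unfold bqf_disc in H4. cbn [bqf_comp qa qb qc m11 m12 m21 m22] in *.
  set (p := ((t + b0 * u) / 2)%Z) in *. set (s := ((t - b0 * u) / 2)%Z) in *.
  clearbody p s n. subst a b c.
  assert (t = p + s)%Z by lia. subst t.
  assert (Hbu : (b0 * u = p - s)%Z) by lia.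
  assert (Hdet : (p * s + a0 * c0 * (u * u) = 1)%Z).
  { assert (E : (4 * (p * s + a0 * c0 * (u * u)) = (p + s) * (p + s) - (b0 * u) * (b0 * u)
      + 4 * a0 * c0 * (u * u))%Z) by (rewrite Hbu; ring).
    assert ((b0 * u) * (b0 * u) = b0 * b0 * (u * u))%Z by ring. lia. }
  split; [rewrite <- Hdet; ring|].
  f_equal.
  - transitivity (n * a0 * (p * (p - b0 * u) + a0 * c0 * (u * u)))%Z; [ring|].
    rewrite Hbu. replace (p - (p - s))%Z with s by ring. rewrite Hdet. ring.
  - transitivity (n * (b0 * (p * s + a0 * c0 * (u * u))
      + 2 * a0 * c0 * u * (p - s - b0 * u)))%Z; [ring|].
    rewrite Hbu, Hdet. ring.
  - transitivity (n * c0 * (s * (s + b0 * u) + a0 * c0 * (u * u)))%Z; [ring|].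
    rewrite Hbu. replace (s + (p - s))%Z with p by ring. rewrite (Z.mul_comm s), Hdet. ring.
Qed.

(** The expression [a|z|^2 + bx + c] is a Hermitian form in [(z, 1)]: its value at [g z] is the
    value of the form for [Q o g] at [z], divided by [|J|^2]. *)
Lemma S_set_mobius (Q : bqf) (g : mat2) (z : C) :
  SL2Z g -> bqf_comp Q g = Q -> S_set Q z -> S_set Q (mobius g z).
Proof.
  intros Hg HQ [Hz HS]. split; [now apply mobius_H|].
  pose proof (automorphy_neq_0 g z Hg Hz) as HJ.
  assert (HJ' : (0 < Cmod (automorphy g z) ^ 2)%R) by (apply pow_lt; now apply Cmod_gt_0).
  pose proof (automorphy_Im g z) as HI. pose proof (automorphy_Re g z) as HR.
  rewrite mobius_alt. rewrite !Cmod_sqr in *.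
  destruct (automorphy g z) as [u v].
  destruct Q as [a b c], g as [p q r s], z as [x y]. unfold ZtoC.
  pose proof (f_equal (fun Q => IZR (qa Q)) HQ) as Ha.
  pose proof (f_equal (fun Q => IZR (qb Q)) HQ) as Hb.
  pose proof (f_equal (fun Q => IZR (qc Q)) HQ) as Hc.
  cbn [bqf_comp qa qb qc m11 m12 m21 m22] in *.
  repeat rewrite ?plus_IZR, ?mult_IZR in Ha. repeat rewrite ?plus_IZR, ?mult_IZR in Hb.
  repeat rewrite ?plus_IZR, ?mult_IZR in Hc.
  cbn [qa qb qc m11 m12 m21 m22] in *.
  set (A := IZR a) in *. set (B := IZR b) in *. set (K := IZR c) in *.
  simpl in *. subst u v.
  match goal with |- ?L = _ => transitivity
   (((A * IZR p * IZR p + B * IZR p * IZR r + K * IZR r * IZR r) * (x * x + y * y)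
     + (2 * A * IZR p * IZR q + B * (IZR p * IZR s + IZR q * IZR r) + 2 * K * IZR r * IZR s) * x
     + (A * IZR q * IZR q + B * IZR q * IZR s + K * IZR s * IZR s))
     / ((IZR r * x + IZR s) * (IZR r * x + IZR s) + IZR r * y * (IZR r * y)))%R end.
  - field. lra.
  - rewrite Ha, Hb, Hc, HS. field. lra.
Qed.

Lemma Cexp_Ci (t : R) : Cexp (Ci * t) = (cos t, sin t).
Proof.
  unfold Cexp. simpl. replace (0 * t - 1 * 0)%R with 0%R by ring.
  replace (0 * 0 + 1 * t)%R with t by ring. rewrite exp_0. f_equal; ring.
Qed.

Lemma S_radius_pos (Q : bqf) : qa Q <> 0%Z -> (0 < bqf_disc Q)%Z -> (0 < S_radius Q)%R.
Proof.
  intros Ha HD. unfold S_radius. apply Rdiv_lt_0_compat.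
  - apply sqrt_lt_R0. now apply IZR_lt.
  - apply Rmult_lt_0_compat; [lra|]. apply Rabs_pos_lt. now apply eq_IZR_contrapositive.
Qed.

Lemma S_point_H (Q : bqf) (t : R) : qa Q <> 0%Z -> (0 < bqf_disc Q)%Z ->
  (0 < t < PI)%R -> upper_half_plane (S_point Q t).
Proof.
  intros Ha HD Ht. unfold S_point, upper_half_plane. rewrite Cexp_Ci. simpl.
  pose proof (S_radius_pos Q Ha HD). pose proof (sin_gt_0 t (proj1 Ht) (proj2 Ht)).
  assert (0 < S_radius Q * sin t)%R by now apply Rmult_lt_0_compat. lra.
Qed.

(** Completing the square gives a circle; as [y > 0], the angle is the arccosine of the normalized
    abscissa and its sine is the positive root. *)
Lemma S_set_point (Q : bqf) (z : C) : qa Q <> 0%Z -> (0 < bqf_disc Q)%Z -> S_set Q z ->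
  exists t : R, (0 < t < PI)%R /\ S_point Q t = z.
Proof.
  intros Ha HD [Hz HS]. pose proof (S_radius_pos Q Ha HD) as Hr.
  assert (Ha' : IZR (qa Q) <> 0%R) by now apply eq_IZR_contrapositive.
  rewrite Cmod_sqr in HS. unfold upper_half_plane in Hz. destruct z as [x y]. simpl in *.
  assert (Hcirc : ((x - S_center Q) * (x - S_center Q) + y * y = S_radius Q * S_radius Q)%R).
  { unfold S_radius, S_center.
    replace (sqrt (IZR (bqf_disc Q)) / (2 * Rabs (IZR (qa Q)))
      * (sqrt (IZR (bqf_disc Q)) / (2 * Rabs (IZR (qa Q)))))%R
      with ((sqrt (IZR (bqf_disc Q)) * sqrt (IZR (bqf_disc Q)))
        / (4 * (Rabs (IZR (qa Q)) * Rabs (IZR (qa Q)))))%R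
      by (field; now apply Rabs_no_R0).
    rewrite sqrt_sqrt by (apply IZR_le; lia).
    rewrite <- Rabs_mult, Rabs_right by (apply Rle_ge, Rle_0_sqr).
    unfold bqf_disc. rewrite minus_IZR, !mult_IZR.
    replace (IZR (qc Q)) with (- (IZR (qa Q) * (x * x + y * y) + IZR (qb Q) * x))%R by lra.
    field. exact Ha'. }
  set (r := S_radius Q) in *. set (m := S_center Q) in *.
  set (w := ((x - m) / r)%R).
  assert (Hw : (w * w + (y / r) * (y / r) = 1)%R).
  { unfold w. replace 1%R with (r * r / (r * r))%R by (field; lra). rewrite <- Hcirc at 1.
    field. lra. }
  assert (Hyr : (0 < y / r)%R) by now apply Rdiv_lt_0_compat.
  assert (Hw1 : (-1 < w < 1)%R) by (split; nra).
  exists (acos w). split.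
  { pose proof (acos_bound_lt w Hw1). exact H. }
  unfold S_point. rewrite Cexp_Ci. fold r m.
  rewrite cos_acos by lra. rewrite sin_acos by lra.
  assert (Hs : sqrt (1 - w²) = (y / r)%R).
  { apply Rsqr_inj; [apply sqrt_pos|lra|]. rewrite Rsqr_sqrt; unfold Rsqr; nra. }
  rewrite Hs. unfold w. apply injective_projections; simpl; field; lra.
Qed.

Lemma derive_rel_curve_continuous (f : R -> C) (s : R) (l : C) :
  derive_rel RtoC f s l -> continuous (U := C_R_NormedModule) f s.
Proof.
  intros H. apply curve_derive_rel in H.
  apply (ex_derive_continuous (K := R_AbsRing) (V := C_R_NormedModule)). now exists l.
Qed.

Lemma FTC_curve (f df : R -> C) (a b : R) :
  (forall s, (Rmin a b <= s <= Rmax a b)%R -> derive_rel RtoC f s (df s)) ->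
  (forall s, (Rmin a b <= s <= Rmax a b)%R -> continuous (U := C_R_NormedModule) df s) ->
  is_RInt (V := C_R_NormedModule) df a b (f b - f a).
Proof.
  intros Hd Hc. apply (is_RInt_derive (V := C_R_CompleteNormedModule) f df a b).
  - intros s Hs. apply curve_derive_rel. now apply Hd.
  - exact Hc.
Qed.

Lemma derive_rel_real (f : R -> R) (s a : R) :
  is_derive f s a -> derive_rel RtoC (fun t => RtoC (f t)) s a.
Proof.
  intros [_ H] eps Heps.
  destruct (H s (fun P HP => HP) (mkposreal eps Heps)) as [d Hd].
  exists d. split; [apply cond_pos|]. intros t Ht.
  rewrite <- !RtoC_minus, <- RtoC_mult, <- RtoC_minus, !Cmod_R.
  rewrite <- RtoC_minus, Cmod_R in Ht. generalize (Hd t Ht).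
  rewrite (Rmult_comm a). intros H1; exact H1.
Qed.

Lemma derive_rel_components (f : R -> C) (s : R) (a b : R) :
  is_derive (fun t => Re (f t)) s a -> is_derive (fun t => Im (f t)) s b ->
  derive_rel RtoC f s (a, b).
Proof.
  intros Ha Hb.
  apply (derive_rel_ext RtoC (fun t => RtoC (Re (f t)) + Ci * RtoC (Im (f t)))).
  { intros t. destruct (f t). apply injective_projections; simpl; ring. }
  replace (a, b) with (RtoC a + Ci * RtoC b) by (apply injective_projections; simpl; ring).
  apply derive_rel_plus; [now apply derive_rel_real|].
  apply derive_rel_scal. now apply derive_rel_real.
Qed.

Lemma S_point_derive (Q : bqf) (t : R) :
  derive_rel RtoC (S_point Q) t (Ci * S_radius Q * Cexp (Ci * t)).
Proof.
  replace (Ci * S_radius Q * Cexp (Ci * t))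
    with ((- S_radius Q * sin t)%R, (S_radius Q * cos t)%R)
    by (rewrite Cexp_Ci; apply injective_projections; simpl; ring).
  apply derive_rel_components; unfold S_point.
  - apply is_derive_ext with (fun s => (S_center Q + S_radius Q * cos s)%R).
    { intros s. rewrite Cexp_Ci. simpl. ring. }
    auto_derive; [trivial|ring].
  - apply is_derive_ext with (fun s => (S_radius Q * sin s)%R).
    { intros s. rewrite Cexp_Ci. simpl. ring. }
    auto_derive; [trivial|ring].
Qed.

(** The two angles may come in either order. In both cases the range between them stays inside []0,
    PI[], hence the arc in the half-plane, and the fundamental theorem carries the orientation. *)
Lemma arc_integral_primitive (f P : C -> C) (Q : bqf) (z z' : C) :
  qa Q <> 0%Z -> (0 < bqf_disc Q)%Z ->
  (forall w, upper_half_plane w -> derive_rel (fun w => w) P w (f w)) ->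
  (forall w, upper_half_plane w -> exists l, derive_rel (fun w => w) f w l) ->
  S_set Q z -> S_set Q z' -> is_arc_integral f Q z z' (P z' - P z).
Proof.
  intros Ha HD HP Hf Hz Hz'.
  destruct (S_set_point Q z Ha HD Hz) as [t [Ht Et]].
  destruct (S_set_point Q z' Ha HD Hz') as [t' [Ht' Et']].
  exists t, t'. do 4 (split; [assumption|]).
  assert (HH : forall s, (Rmin t t' <= s <= Rmax t t')%R -> upper_half_plane (S_point Q s)).
  { intros s Hs. apply S_point_H; try assumption. revert Hs.
    unfold Rmin, Rmax. destruct (Rle_dec t t'); lra. }
  rewrite <- Et, <- Et'.
  apply (FTC_curve (fun s => P (S_point Q s))).
  - intros s Hs. apply (derive_rel_comp RtoC P (S_point Q)); [now apply HP, HH|].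
    apply S_point_derive.
  - intros s Hs. destruct (Hf _ (HH s Hs)) as [l Hl]. eapply derive_rel_curve_continuous.
    apply (derive_rel_mult RtoC (fun s => f (S_point Q s))
      (fun s => Ci * S_radius Q * Cexp (Ci * s))).
    + apply (derive_rel_comp RtoC f (S_point Q)); [exact Hl|apply S_point_derive].
    + apply (derive_rel_scal RtoC (Ci * S_radius Q) (fun s => Cexp (Ci * s))).
      apply (derive_rel_ext RtoC (fun s => (cos s, sin s))).
      { intros t''. now rewrite Cexp_Ci. }
      apply (derive_rel_components (fun s => (cos s, sin s))); simpl; auto_derive; auto.
Qed.

(** * The complex exponential and q-expansions *)

Lemma Cexp_plus (a b : C) : Cexp (a + b) = Cexp a * Cexp b.
Proof.
  unfold Cexp. destruct a as [x y], b as [x' y']. simpl.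
  rewrite exp_plus, cos_plus, sin_plus. apply injective_projections; simpl; ring.
Qed.

Lemma Cexp_0 : Cexp 0 = 1.
Proof. unfold Cexp. simpl. rewrite exp_0, cos_0, sin_0. apply injective_projections; simpl; ring. Qed.

Lemma Cexp_R (x : R) : Cexp x = exp x.
Proof. unfold Cexp. simpl. rewrite cos_0, sin_0. apply injective_projections; simpl; ring. Qed.

Lemma Cmod_Cexp (z : C) : Cmod (Cexp z) = exp (Re z).
Proof.
  unfold Cmod, Cexp. destruct z as [x y]. simpl.
  replace (exp x * cos y * (exp x * cos y * 1) + exp x * sin y * (exp x * sin y * 1))%R
    with (exp x * exp x * (Rsqr (sin y) + Rsqr (cos y)))%R by (unfold Rsqr; ring).
  rewrite sin2_cos2, Rmult_1_r. apply sqrt_square. apply Rlt_le, exp_pos.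
Qed.

Lemma exp_le_mono (x y : R) : (x <= y)%R -> (exp x <= exp y)%R.
Proof. intros [H| ->]; [now apply Rlt_le, exp_increasing|lra]. Qed.

(** Real calculus on the two components. Applied along segments from 0, it yields the remainder
    bounds from which the complex derivative of [Cexp] is then deduced. *)
Lemma Cexp_line_derive (w : C) (s : R) :
  derive_rel RtoC (fun s => Cexp (s * w)) s (w * Cexp (s * w)).
Proof.
  destruct w as [x y].
  assert (E : forall t : R, Cexp (t * (x, y)) = ((exp (t * x) * cos (t * y))%R, (exp (t * x) * sin (t * y))%R)).
  { intros t. unfold Cexp. simpl. f_equal; f_equal; f_equal; ring. }
  replace ((x, y) * Cexp (s * (x, y)))
    with ((x * exp (s * x) * cos (s * y) + exp (s * x) * (y * - sin (s * y)))%R,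
          (x * exp (s * x) * sin (s * y) + exp (s * x) * (y * cos (s * y)))%R)
    by (rewrite E; apply injective_projections; simpl; ring).
  apply derive_rel_components.
  - apply is_derive_ext with (fun t => (exp (t * x) * cos (t * y))%R).
    { intros t. now rewrite E. }
    auto_derive; [trivial|ring].
  - apply is_derive_ext with (fun t => (exp (t * x) * sin (t * y))%R).
    { intros t. now rewrite E. }
    auto_derive; [trivial|ring].
Qed.

(** For complex values the increment is bounded through the integral of [df]; the second derivative
    makes [df] continuous, hence integrable. *)
Lemma unit_mean_value (f df d2f : R -> C) (M : R) :
  (forall s, (0 <= s <= 1)%R -> derive_rel RtoC f s (df s)) ->
  (forall s, (0 <= s <= 1)%R -> derive_rel RtoC df s (d2f s)) ->
  (forall s, (0 <= s <= 1)%R -> (Cmod (df s) <= M)%R) ->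
  (Cmod (f 1%R - f 0%R) <= M)%R.
Proof.
  intros Hd Hc HM.
  assert (HI : is_RInt (V := C_R_NormedModule) df 0 1 (f 1%R - f 0%R)).
  { apply FTC_curve; intros s; rewrite Rmin_left, Rmax_right by lra; intros Hs.
    - now apply Hd.
    - eapply derive_rel_curve_continuous. now apply Hc. }
  rewrite Cmod_norm. replace M with (scal (1 - 0)%R M) by (unfold scal; simpl; unfold mult; simpl; ring).
  apply (norm_RInt_le (V := C_R_NormedModule) df (fun _ => M) 0 1); [lra| |exact HI|].
  - intros s Hs. rewrite <- Cmod_norm. now apply HM.
  - apply (is_RInt_const (V := R_NormedModule) 0 1 M).
Qed.

Lemma Cexp_sub_1_bound (w : C) : (Cmod (Cexp w - 1) <= Cmod w * exp (Cmod w))%R.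
Proof.
  replace (Cexp w - 1) with (Cexp (1%R * w) - Cexp (0%R * w))
    by (rewrite Cmult_0_l, Cexp_0, Cmult_1_l; ring).
  apply (unit_mean_value (fun s => Cexp (s * w)) (fun s => w * Cexp (s * w))
    (fun s => w * (w * Cexp (s * w)))).
  - intros s _. apply Cexp_line_derive.
  - intros s _. apply derive_rel_scal, Cexp_line_derive.
  - intros s Hs. rewrite Cmod_mult, Cmod_Cexp. apply Rmult_le_compat_l; [apply Cmod_ge_0|].
    apply exp_le_mono. eapply Rle_trans; [apply Rle_abs|]. eapply Rle_trans; [apply re_le_Cmod|].
    rewrite Cmod_mult, Cmod_R, Rabs_right by lra. pose proof (Cmod_ge_0 w). nra.
Qed.

(** The mean value bound for [Cexp (s w) - s w], whose derivative [w (Cexp (s w) - 1)] is controlled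
    by the first-order bound. *)
Lemma Cexp_taylor_bound (w : C) :
  (Cmod (Cexp w - 1 - w) <= Cmod w * Cmod w * exp (Cmod w))%R.
Proof.
  assert (Hd : forall s : R, derive_rel RtoC (fun s => Cexp (s * w) + - (1) * (s * w)) s
     (w * Cexp (s * w) + - (1) * w)).
  { intros s. apply derive_rel_plus; [apply Cexp_line_derive|]. apply derive_rel_scal.
    apply (derive_rel_ext RtoC (fun s : R => w * s)); [intros; ring|].
    apply (derive_rel_linear RtoC w). }
  replace (Cexp w - 1 - w) with ((Cexp (1%R * w) + - (1) * (1%R * w))
    - (Cexp (0%R * w) + - (1) * (0%R * w))).
  2:{ rewrite Cmult_0_l, Cexp_0, Cmult_1_l. ring. }
  apply (unit_mean_value (fun s => Cexp (s * w) + - (1) * (s * w))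
    (fun s => w * Cexp (s * w) + - (1) * w) (fun s => w * (w * Cexp (s * w)) + 0)).
  - intros s _. apply Hd.
  - intros s _. apply derive_rel_plus; [apply derive_rel_scal, Cexp_line_derive|].
    apply (derive_rel_const RtoC).
  - intros s Hs. replace (w * Cexp (s * w) + - (1) * w) with (w * (Cexp (s * w) - 1)) by ring.
    rewrite Cmod_mult, Rmult_assoc. apply Rmult_le_compat_l; [apply Cmod_ge_0|].
    eapply Rle_trans; [apply Cexp_sub_1_bound|].
    rewrite Cmod_mult, Cmod_R, Rabs_right by lra. pose proof (Cmod_ge_0 w).
    apply Rmult_le_compat; [nra|apply Rlt_le, exp_pos|nra|]. apply exp_le_mono. nra.
Qed.

(** The common criterion for differentiating [Cexp], q-series and Laplace transforms: summing or
    integrating the second-order remainder of the exponential replaces a theorem on the interchange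
    of limits. *)
Lemma derive_rel_quadratic (f : C -> C) (z l : C) (d K : R) :
  (0 < d)%R ->
  (forall h, (Cmod h < d)%R -> (Cmod (f (z + h)%C - f z - l * h) <= K * (Cmod h * Cmod h))%R) ->
  derive_rel (fun w => w) f z l.
Proof.
  intros Hd H eps Heps. pose proof (Rabs_pos K) as HK.
  exists (Rmin d (eps / (Rabs K + 1))). split.
  { apply Rmin_pos; [exact Hd|]. apply Rdiv_lt_0_compat; lra. }
  intros w Hw. pose proof (Rmin_l d (eps / (Rabs K + 1))).
  pose proof (Rmin_r d (eps / (Rabs K + 1))).
  specialize (H (w - z) ltac:(lra)). replace (z + (w - z)) with w in H by ring.
  eapply Rle_trans; [exact H|]. set (r := Cmod (w - z)) in *.
  assert (Hr : (0 <= r)%R) by apply Cmod_ge_0.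
  apply Rle_trans with ((Rabs K + 1) * (r * r))%R.
  { apply Rmult_le_compat_r; [nra|]. pose proof (Rle_abs K). lra. }
  replace (eps * r)%R with ((Rabs K + 1) * (eps / (Rabs K + 1) * r))%R by (field; lra).
  apply Rmult_le_compat_l; [lra|]. apply Rmult_le_compat_r; lra.
Qed.

Lemma Cexp_derive (z : C) : derive_rel (fun w => w) Cexp z (Cexp z).
Proof.
  apply derive_rel_quadratic with 1%R (exp (Re z) * exp 1)%R; [lra|].
  intros h Hh. rewrite Cexp_plus.
  replace (Cexp z * Cexp h - Cexp z - Cexp z * h) with (Cexp z * (Cexp h - 1 - h)) by ring.
  rewrite Cmod_mult, Cmod_Cexp, Rmult_assoc.
  apply Rmult_le_compat_l; [apply Rlt_le, exp_pos|].
  eapply Rle_trans; [apply Cexp_taylor_bound|]. rewrite Rmult_comm.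
  pose proof (Cmod_ge_0 h). apply Rmult_le_compat_r; [nra|]. apply exp_le_mono. lra.
Qed.

Lemma Cexp_scal_derive {T : Type} (e : T -> C) (c : C) (t : T) :
  derive_rel e (fun t => Cexp (c * e t)) t (c * Cexp (c * e t)).
Proof.
  rewrite (Cmult_comm c (Cexp _)).
  apply (derive_rel_comp e Cexp (fun t => c * e t)); [apply Cexp_derive|].
  apply derive_rel_linear.
Qed.

Lemma filterlim_C {T : Type} (F : (T -> Prop) -> Prop) {FF : Filter F} (f : T -> C) (l : C) :
  filterlim f F (locally (T := C_UniformSpace) l) <->
  forall eps : R, (0 < eps)%R -> F (fun t => (Cmod (f t - l) < eps)%R).
Proof.
  split.
  - intros H eps Heps.
    exact (proj1 (filterlim_locally_ball_norm (K := C_AbsRing) (U := C_NormedModule) f l) H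
      (mkposreal eps Heps)).
  - intros H. apply (filterlim_locally_ball_norm (K := C_AbsRing) (U := C_NormedModule) f l).
    intros eps. apply (H eps (cond_pos eps)).
Qed.

Lemma filterlim_Cmod_le {T : Type} (F : (T -> Prop) -> Prop) {FF : ProperFilter F}
    (f : T -> C) (l : C) (M : R) :
  filterlim f F (locally (T := C_UniformSpace) l) ->
  F (fun t => (Cmod (f t) <= M)%R) -> (Cmod l <= M)%R.
Proof.
  intros Hl HM. destruct (Rle_lt_dec (Cmod l) M) as [H|H]; [exact H|exfalso].
  pose proof (proj1 (filterlim_C F f l) Hl (Cmod l - M)%R ltac:(lra)) as H1.
  destruct (filter_ex _ (filter_and _ _ HM H1)) as [t [Ht Ht']].
  assert (Cmod l <= Cmod (f t) + Cmod (f t - l))%R.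
  { replace l with (f t + - (f t - l)) at 1 by ring. rewrite <- (Cmod_opp (f t - l)).
    apply Cmod_triangle. }
  lra.
Qed.

Notation C_series a l := (is_series (K := C_AbsRing) (V := C_NormedModule) a l).

Lemma C_series_bound (a : nat -> C) (d : nat -> R) (l : C) (D : R) :
  C_series a l -> is_series d D -> (forall n, (Cmod (a n) <= d n)%R) -> (Cmod l <= D)%R.
Proof.
  intros Ha Hd H.
  apply (filterlim_Cmod_le eventually (sum_n (G := C_NormedModule) a) l D Ha).
  exists O. intros n _.
  apply Rle_trans with (sum_n d n).
  - eapply Rle_trans; [apply (norm_sum_n_m (K := C_AbsRing) (V := C_NormedModule) a)|].
    apply sum_n_m_le. intros k. apply H.
  - apply (is_lim_seq_incr_compare (sum_n d) D); [exact Hd|]. intros k. rewrite sum_Sn.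
    assert (0 <= d (S k))%R by (eapply Rle_trans; [apply Cmod_ge_0|apply H]).
    unfold plus; simpl. lra.
Qed.

Lemma C_series_bounded_terms (a : nat -> C) (l : C) :
  C_series a l -> exists M : R, forall n, (Cmod (a n) <= M)%R.
Proof.
  intros H.
  assert (Hs : exists M : R, forall n, (Cmod (sum_n (G := C_NormedModule) a n) <= M)%R).
  { destruct (proj1 (filterlim_C eventually _ l) H 1%R Rlt_0_1) as [N HN].
    assert (Hfin : exists M, forall n, (n <= N)%nat -> (Cmod (sum_n (G := C_NormedModule) a n) <= M)%R).
    { clear HN. induction N as [|N [M HM]].
      - exists (Cmod (sum_n (G := C_NormedModule) a 0)). intros n Hn.
        replace n with O by lia. lra.
      - exists (Rmax M (Cmod (sum_n (G := C_NormedModule) a (S N)))). intros n Hn.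
        destruct (Nat.eq_dec n (S N)) as [->|Hne]; [apply Rmax_r|].
        eapply Rle_trans; [apply HM; lia|apply Rmax_l]. }
    destruct Hfin as [M HM]. exists (Rmax M (Cmod l + 1)). intros n.
    destruct (le_lt_dec n N) as [Hn|Hn].
    - eapply Rle_trans; [now apply HM|apply Rmax_l].
    - eapply Rle_trans; [|apply Rmax_r]. specialize (HN n ltac:(lia)).
      set (x := sum_n (G := C_NormedModule) a n) in *. change (sum_n a n) with x in HN.
      replace x with ((x - l) + l) by ring.
      eapply Rle_trans; [apply Cmod_triangle|]. lra. }
  destruct Hs as [M HM]. exists (2 * M)%R. intros n. destruct n as [|n].
  - specialize (HM O). rewrite sum_O in HM. pose proof (Cmod_ge_0 (a O)). lra.
  - pose proof (HM n) as H1. pose proof (HM (S n)) as H2. rewrite sum_Sn in H2.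
    set (x := sum_n (G := C_NormedModule) a n) in *. change (plus x (a (S n))) with (x + a (S n)) in H2.
    replace (a (S n)) with ((x + a (S n)) + - x) by ring.
    eapply Rle_trans; [apply Cmod_triangle|]. rewrite Cmod_opp. lra.
Qed.

Lemma exp_ge_id (t : R) : (t <= exp t)%R.
Proof. pose proof (exp_ineq1_le t). lra. Qed.

Lemma exp_ge_square (t : R) : (0 <= t)%R -> (t * t <= 4 * exp t)%R.
Proof.
  intros Ht. replace t with (t / 2 + t / 2)%R at 3 by field. rewrite exp_plus.
  pose proof (exp_ge_id (t / 2)). pose proof (exp_pos (t / 2)). nra.
Qed.

Lemma geometric_exp_series (x : R) : (0 < x)%R ->
  is_series (fun n => exp (- (INR n * x))) (/ (1 - exp (- x)))%R.
Proof.
  intros Hx.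
  apply (is_series_ext (K := R_AbsRing) (V := R_NormedModule) (fun n => exp (- x) ^ n)%R).
  { intros n. induction n as [|n IH].
    - simpl. now rewrite Rmult_0_l, Ropp_0, exp_0.
    - rewrite S_INR. simpl. rewrite IH, <- exp_plus. f_equal. ring. }
  apply is_series_geom. rewrite Rabs_right by (apply Rle_ge, Rlt_le, exp_pos).
  rewrite <- exp_0. apply exp_increasing. lra.
Qed.

(** * Series in q *)

Definition qexp (n : nat) (z : C) : C := Cexp (2 * PI * Ci * INR n * z).

Lemma Cmod_qexp (n : nat) (z : C) : Cmod (qexp n z) = exp (- (2 * PI * INR n * Im z)).
Proof. unfold qexp. rewrite Cmod_Cexp. destruct z as [x y]. simpl. f_equal. ring. Qed.

Lemma qexp_derive (n : nat) (z : C) :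
  derive_rel (fun w => w) (qexp n) z (2 * PI * Ci * INR n * qexp n z).
Proof. apply (Cexp_scal_derive (fun w => w)). Qed.

(* Compare with the terms of the series at height y / 2. *)
Lemma qseries_decay (a : nat -> C) (A : C -> C) (y : R) : (0 < y)%R ->
  (forall z, upper_half_plane z -> C_series (fun n => a n * qexp n z) (A z)) ->
  exists M : R, (0 <= M)%R /\ forall n z, (y <= Im z)%R ->
    (Cmod (a n * qexp n z) <= M * exp (- (INR n * (PI * (2 * Im z - y)))))%R.
Proof.
  intros Hy H. set (z1 := (0, y / 2)%R : C).
  destruct (C_series_bounded_terms _ _ (H z1 ltac:(unfold upper_half_plane; simpl; lra)))
    as [M HM].
  exists M. split; [eapply Rle_trans; [apply Cmod_ge_0|apply (HM O)]|].
  intros n z Hz. specialize (HM n). rewrite Cmod_mult, Cmod_qexp in *. simpl in HM.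
  replace (exp (- (2 * PI * INR n * Im z)))%R with
    (exp (- (2 * PI * INR n * (y / 2))) * exp (- (INR n * (PI * (2 * Im z - y)))))%R
    by (rewrite <- exp_plus; f_equal; field).
  rewrite <- Rmult_assoc. apply Rmult_le_compat_r; [apply Rlt_le, exp_pos|exact HM].
Qed.

Lemma qseries_derive (a : nat -> C) (A : C -> C) :
  (forall z, upper_half_plane z -> C_series (fun n => a n * qexp n z) (A z)) ->
  forall z, upper_half_plane z -> exists l : C,
    C_series (fun n => 2 * PI * Ci * INR n * (a n * qexp n z)) l /\
    derive_rel (fun w => w) A z l.
Proof.
  intros H z Hz. pose proof PI_RGT_0 as HPI. unfold upper_half_plane in Hz.
  destruct (qseries_decay a A (Im z) Hz H) as [M [HM0 HM]].
  (* The decay [exp (- 4 n x)] of the terms at [z] is a budget of four units of [t = n x]. In the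
     remainder, [|2 pi n h| <= 2t] for [|h| < y / 4] costs two units in the exponential, and
     [t^2 <= 4 exp t] costs one. The last unit makes the series geometric. *)
  set (y := Im z) in *. set (x := (PI * y / 4)%R).
  assert (Hx : (0 < x)%R) by (unfold x; apply Rdiv_lt_0_compat; [apply Rmult_lt_0_compat; lra|lra]).
  pose proof (geometric_exp_series x Hx) as Hg. set (K := (/ (1 - exp (- x)))%R) in *.
  assert (Hb : forall n, (Cmod (a n * qexp n z) <= M * exp (- (INR n * (4 * x))))%R).
  { intros n. eapply Rle_trans; [apply (HM n z), Rle_refl|]. fold y.
    replace (PI * (2 * y - y))%R with (4 * x)%R by (unfold x; field). lra. }
  assert (Hcmod : forall n, Cmod (2 * PI * Ci * INR n) = (2 * PI * INR n)%R).
  { intros n. rewrite !Cmod_mult, Cmod_Ci, !Cmod_R.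
    rewrite !Rabs_right; try lra. apply Rle_ge, pos_INR. }
  assert (Hl : ex_series (K := C_AbsRing) (V := C_CompleteNormedModule)
    (fun n => 2 * PI * Ci * INR n * (a n * qexp n z))).
  { apply (ex_series_le (K := C_AbsRing) (V := C_CompleteNormedModule) _
      (fun n => (2 * PI * M / x) * exp (- (INR n * x)))%R).
    2:{ exists ((2 * PI * M / x) * K)%R. apply (is_series_scal (K := R_AbsRing) (V := R_NormedModule)).
        exact Hg. }
    intros n.
    change (norm (K := C_AbsRing) (V := C_CompleteNormedModule) (2 * PI * Ci * INR n * (a n * qexp n z)))
      with (Cmod (2 * PI * Ci * INR n * (a n * qexp n z))).
    rewrite Cmod_mult, Hcmod.
    pose proof (pos_INR n) as Hn.
    apply Rle_trans with (2 * PI * INR n * (M * exp (- (INR n * (4 * x)))))%R.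
    { apply Rmult_le_compat_l; [|apply Hb]. apply Rmult_le_pos; lra. }
    apply Rle_trans with (2 * PI * M / x * ((INR n * x) * exp (- (INR n * (4 * x)))))%R.
    { right. field. lra. }
    apply Rmult_le_compat_l.
    { apply Rmult_le_pos; [|apply Rlt_le, Rinv_0_lt_compat; lra].
      apply Rmult_le_pos; lra. }
    apply Rle_trans with (exp (INR n * x) * exp (- (INR n * (4 * x))))%R.
    { apply Rmult_le_compat_r; [apply Rlt_le, exp_pos|apply exp_ge_id]. }
    rewrite <- exp_plus. apply exp_le_mono. assert (0 <= INR n * x)%R by (apply Rmult_le_pos; lra). lra. }
  destruct Hl as [l Hl]. exists l. split; [exact Hl|].
  (* Since [|2 pi n h| = (8 / y) |h| t], its square gives 64 and [exp_ge_square] a further 4. *)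
  apply derive_rel_quadratic with (y / 4)%R (256 / (y * y) * M * K)%R; [lra|].
  intros h Hh.
  assert (Hzh : upper_half_plane (z + h)).
  { unfold upper_half_plane. pose proof (im_le_Cmod h) as Hi. destruct z, h. simpl in *.
    apply Rabs_le_between in Hi. unfold y in *. lra. }
  pose proof (Cmod_ge_0 h) as Hh0.
  assert (HS : C_series (fun n => a n * qexp n z *
      (Cexp (2 * PI * Ci * INR n * h) - 1 - 2 * PI * Ci * INR n * h))
      (A (z + h) - A z - h * l)).
  { pose proof (is_series_minus (K := C_AbsRing) (V := C_NormedModule) _ _ _ _
      (is_series_minus (K := C_AbsRing) (V := C_NormedModule) _ _ _ _ (H _ Hzh) (H _ Hz))
      (is_series_scal (K := C_AbsRing) (V := C_NormedModule) h _ _ Hl)) as HS.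
    eapply is_series_ext; [|exact HS]. intros n.
    change (((a n * qexp n (z + h)) + - (a n * qexp n z)) + - (h * (2 * PI * Ci * INR n * (a n * qexp n z)))
      = a n * qexp n z * (Cexp (2 * PI * Ci * INR n * h) - 1 - 2 * PI * Ci * INR n * h)).
    replace (qexp n (z + h)) with (qexp n z * Cexp (2 * PI * Ci * INR n * h))
      by (unfold qexp; rewrite <- Cexp_plus; f_equal; ring).
    ring. }
  rewrite (Cmult_comm l h).
  apply (C_series_bound _ (fun n => (256 / (y * y) * M * (Cmod h * Cmod h)) * exp (- (INR n * x)))%R
    _ _ HS).
  - replace (256 / (y * y) * M * K * (Cmod h * Cmod h))%R
      with ((256 / (y * y) * M * (Cmod h * Cmod h)) * K)%R by ring.
    apply (is_series_scal (K := R_AbsRing) (V := R_NormedModule)). exact Hg.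
  - intros n. pose proof (pos_INR n) as Hn. rewrite Cmod_mult.
    set (t := (INR n * x)%R).
    assert (Ht : (0 <= t)%R) by (apply Rmult_le_pos; lra).
    set (w := 2 * PI * Ci * INR n * h).
    assert (Hw : Cmod w = (8 / y * Cmod h * t)%R).
    { unfold w, t, x. rewrite Cmod_mult, Hcmod. field. lra. }
    assert (Hw2 : (Cmod w <= 2 * t)%R).
    { rewrite Hw. apply Rmult_le_compat_r; [exact Ht|].
      apply Rmult_le_reg_r with y; [exact Hz|].
      replace (8 / y * Cmod h * y)%R with (8 * Cmod h)%R by (field; lra). lra. }
    apply Rle_trans with ((M * exp (- (4 * t))) * ((64 / (y * y) * (Cmod h * Cmod h) * (t * t)) * exp (2 * t)))%R.
    { apply Rmult_le_compat; try apply Cmod_ge_0.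
      - eapply Rle_trans; [apply Hb|]. right. unfold t. do 2 f_equal. ring.
      - eapply Rle_trans; [apply Cexp_taylor_bound|].
        apply Rmult_le_compat.
        + pose proof (Cmod_ge_0 w). nra.
        + apply Rlt_le, exp_pos.
        + rewrite Hw. right. field. lra.
        + now apply exp_le_mono. }
    assert (HC : (0 <= 64 / (y * y) * M * (Cmod h * Cmod h))%R).
    { apply Rmult_le_pos; [apply Rmult_le_pos; [|exact HM0]|nra].
      apply Rlt_le, Rdiv_lt_0_compat; nra. }
    apply Rle_trans with ((64 / (y * y) * M * (Cmod h * Cmod h)) * ((4 * exp t) * (exp (2 * t) * exp (- (4 * t)))))%R.
    { replace (M * exp (- (4 * t)) * (64 / (y * y) * (Cmod h * Cmod h) * (t * t) * exp (2 * t)))%R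
       with ((64 / (y * y) * M * (Cmod h * Cmod h)) * ((t * t) * (exp (2 * t) * exp (- (4 * t)))))%R by ring.
      apply Rmult_le_compat_l; [exact HC|]. apply Rmult_le_compat_r; [|now apply exp_ge_square].
      apply Rmult_le_pos; apply Rlt_le, exp_pos. }
    replace (4 * exp t * (exp (2 * t) * exp (- (4 * t))))%R with (4 * exp (- t))%R
      by (replace (- t)%R with (t + (2 * t + - (4 * t)))%R by ring; rewrite !exp_plus; ring).
    right. field. lra.
Qed.

(* f = sum_n a_n q^(n - N) on the upper half-plane. *)
Definition expansion (N : nat) (a : nat -> C) (f : C -> C) : Prop :=
  forall z, upper_half_plane z -> C_series (fun n => a n * qexp n z) (qexp N z * f z).

Lemma qexp_neq_0 (n : nat) (z : C) : qexp n z <> 0.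
Proof. apply Cmod_gt_0. rewrite Cmod_qexp. apply exp_pos. Qed.

Lemma two_pi_i_neq_0 : 2 * PI * Ci <> 0.
Proof.
  pose proof PI_RGT_0. intros E. apply (f_equal Im) in E. simpl in E. lra.
Qed.

(** The power series belongs to [q^N f]; dividing by [q^N] shifts the exponents, hence [n - N]. The
    first half certifies that the total function [calD f] is a genuine derivative, which the next
    differentiation needs. *)
Lemma expansion_calD (N : nat) (a : nat -> C) (f : C -> C) : expansion N a f ->
  (forall z, upper_half_plane z ->
     derive_rel (fun w => w) f z (2 * PI * Ci * calD f z)) /\
  expansion N (fun n => (INR n - INR N) * a n) (calD f).
Proof.
  intros H.
  assert (HD : forall z, upper_half_plane z ->
    derive_rel (fun w => w) f z (2 * PI * Ci * calD f z) /\
    C_series (fun n => (INR n - INR N) * a n * qexp n z) (qexp N z * calD f z)).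
  { intros z Hz. destruct (qseries_derive a _ H z Hz) as [l [Hl Hd]].
    pose proof (qexp_neq_0 N) as Hq.
    set (l' := l * / qexp N z + qexp N z * f z * (- (2 * PI * Ci * INR N * qexp N z) / (qexp N z * qexp N z))).
    assert (Hf : derive_rel (fun w => w) f z l').
    { apply (derive_rel_ext (fun w => w) (fun w => (qexp N w * f w) * / qexp N w)).
      { intros w. field. apply Hq. }
      apply (derive_rel_mult (fun w => w) (fun w => qexp N w * f w) (fun w => / qexp N w));
        [exact Hd|].
      apply derive_rel_inv; [apply Hq|apply qexp_derive]. }
    assert (El : calD f z = l' / (2 * PI * Ci)).
    { unfold calD. f_equal. apply is_C_derive_unique. now apply Cderive_rel. }
    split.
    - rewrite El. replace (2 * PI * Ci * (l' / (2 * PI * Ci))) with l'; [exact Hf|].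
      generalize two_pi_i_neq_0. generalize (2 * PI * Ci). intros c Hc. field. exact Hc.
    - pose proof (is_series_minus (K := C_AbsRing) (V := C_NormedModule) _ _ _ _
        (is_series_scal (K := C_AbsRing) (V := C_NormedModule) (/ (2 * PI * Ci)) _ _ Hl)
        (is_series_scal (K := C_AbsRing) (V := C_NormedModule) (RtoC (INR N)) _ _ (H z Hz))) as HS.
      assert (Hc := two_pi_i_neq_0). rewrite El. unfold l'.
      set (c := 2 * PI * Ci) in *. clearbody c.
      replace (qexp N z * ((l * / qexp N z + qexp N z * f z * (- (c * INR N * qexp N z) / (qexp N z * qexp N z))) / c))
        with (/ c * l + - (INR N * (qexp N z * f z))) by (field; auto).
      eapply is_series_ext; [|exact HS]. intros n.
      change (/ c * (c * INR n * (a n * qexp n z)) + - (INR N * (a n * qexp n z))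
        = (INR n - INR N) * a n * qexp n z).
      field. exact Hc. }
  split; intros z Hz; now apply HD.
Qed.

(** Recursively [(n - N)^j a n]. At [n = N], the constant term, it is 0 as soon as [j > 0]. *)
Fixpoint iter_coef (N : nat) (a : nat -> C) (j n : nat) : C :=
  match j with
  | O => a n
  | S j' => (INR n - INR N) * iter_coef N a j' n
  end.

Lemma expansion_calD_n (N : nat) (a : nat -> C) (f : C -> C) (j : nat) :
  expansion N a f -> expansion N (iter_coef N a j) (calD_n j f).
Proof.
  intros H. induction j as [|j IH]; [exact H|]. apply (expansion_calD _ _ _ IH).
Qed.

(** The powers of [2 pi i] undo the normalization of [calD], leaving the plain derivatives that
    [jet] requires. *)
Definition deriv_jet (f : C -> C) (i : nat) (z : C) : C := (2 * PI * Ci) ^ i * calD_n i f z.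

Lemma deriv_jet_jet (N : nat) (a : nat -> C) (f : C -> C) :
  expansion N a f -> jet (deriv_jet f).
Proof.
  intros H i z Hz. unfold deriv_jet. rewrite Cpow_S.
  replace (2 * PI * Ci * (2 * PI * Ci) ^ i * calD_n (S i) f z)
    with ((2 * PI * Ci) ^ i * (2 * PI * Ci * calD (calD_n i f) z)) by (simpl; ring).
  apply derive_rel_scal.
  now apply (proj1 (expansion_calD _ _ _ (expansion_calD_n N a f i H))).
Qed.

(** * Improper integrals and Laplace transforms *)

Lemma exp_decay_RInt (K eta a b : R) : eta <> 0%R ->
  is_RInt (fun s => K * exp (- (eta * s)))%R a b (K / eta * (exp (- (eta * a)) - exp (- (eta * b))))%R.
Proof.
  intros He.
  replace (K / eta * (exp (- (eta * a)) - exp (- (eta * b))))%R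
    with (minus (- K / eta * exp (- (eta * b)))%R (- K / eta * exp (- (eta * a)))%R)
    by (unfold minus, plus, opp; simpl; field; exact He).
  apply (is_RInt_derive (fun s => - K / eta * exp (- (eta * s)))%R).
  - intros s _. auto_derive; [trivial|]. field. exact He.
  - intros s _. apply (ex_derive_continuous (K := R_AbsRing) (V := R_NormedModule)). auto_derive. trivial.
Qed.

Lemma RInt_decay_bound (g : R -> C) (K eta a b : R) (I : C) :
  (0 < eta)%R -> (0 <= K)%R -> (0 <= a <= b)%R ->
  (forall s, (0 <= s)%R -> (Cmod (g s) <= K * exp (- (eta * s)))%R) ->
  is_RInt (V := C_R_NormedModule) g a b I -> (Cmod I <= K / eta * exp (- (eta * a)))%R.
Proof.
  intros He HK Hab Hg HI.
  apply Rle_trans with (K / eta * (exp (- (eta * a)) - exp (- (eta * b))))%R.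
  - rewrite Cmod_norm.
    apply (norm_RInt_le (V := C_R_NormedModule) g (fun s => K * exp (- (eta * s)))%R a b); [lra| |exact HI|].
    + intros s Hs. rewrite <- Cmod_norm. apply Hg. lra.
    + apply exp_decay_RInt. lra.
  - apply Rmult_le_compat_l.
    + apply Rmult_le_pos; [exact HK|]. apply Rlt_le, Rinv_0_lt_compat. exact He.
    + pose proof (exp_pos (- (eta * b))). lra.
Qed.

Notation integral_to_infinity g v :=
  (is_RInt_gen (V := C_R_NormedModule) g (at_point 0%R) (Rbar_locally p_infty) v).

Lemma integral_to_infinity_spec (g : R -> C) (v : C) :
  integral_to_infinity g v <->
  forall eps : R, (0 < eps)%R -> exists B : R, forall b : R, (B < b)%R ->
    exists I : C, is_RInt (V := C_R_NormedModule) g 0 b I /\ (Cmod (I - v) < eps)%R.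
Proof.
  split.
  - intros H eps Heps.
    assert (HP : locally (T := C_UniformSpace) v (fun I => (Cmod (I - v) < eps)%R)).
    { apply (proj1 (filterlim_C (locally (T := C_UniformSpace) v) (fun I => I) v)); [|exact Heps].
      intros P HP. exact HP. }
    specialize (H _ HP). destruct H as [P1 P2 H1 [B HB] H].
    exists B. intros b Hb. destruct (H 0%R b H1 (HB b Hb)) as [I HI]. exists I. exact HI.
  - intros H P HP.
    destruct (locally_norm_le_locally (K := C_AbsRing) (V := C_NormedModule) v P HP) as [eps Heps].
    destruct (H eps (cond_pos eps)) as [B HB].
    apply (Filter_prod _ _ _ (fun a => a = 0%R) (fun b => (B < b)%R)).
    + reflexivity.
    + now exists B.
    + intros a b -> Hb. destruct (HB b Hb) as [I [HI HI']]. exists I. split; [exact HI|].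
      now apply Heps.
Qed.

Lemma integral_to_infinity_unique (g : R -> C) (v w : C) :
  integral_to_infinity g v -> integral_to_infinity g w -> v = w.
Proof.
  intros Hv Hw.
  rewrite <- (is_RInt_gen_unique (V := C_R_CompleteNormedModule) g v Hv).
  exact (is_RInt_gen_unique (V := C_R_CompleteNormedModule) g w Hw).
Qed.

Lemma integral_to_infinity_plus (g h : R -> C) (v w : C) :
  integral_to_infinity g v -> integral_to_infinity h w ->
  integral_to_infinity (fun s => g s + h s) (v + w).
Proof. apply (is_RInt_gen_plus (V := C_R_NormedModule) g h v w). Qed.

(** The integral takes values in [C] as a real vector space, so a complex factor is not one of its
    scalars and has to be treated on real and imaginary parts. *)
Lemma is_RInt_C_scal (c : C) (g : R -> C) (a b : R) (I : C) :
  is_RInt (V := C_R_NormedModule) g a b I ->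
  is_RInt (V := C_R_NormedModule) (fun s => c * g s) a b (c * I).
Proof.
  intros H.
  pose proof (is_RInt_fct_extend_fst (U := R_NormedModule) (V := R_NormedModule) _ _ _ _ H) as H1.
  pose proof (is_RInt_fct_extend_snd (U := R_NormedModule) (V := R_NormedModule) _ _ _ _ H) as H2.
  apply (is_RInt_fct_extend_pair (U := R_NormedModule) (V := R_NormedModule)
    (fun s => c * g s) a b (fst (c * I)) (snd (c * I))).
  - exact (is_RInt_minus (V := R_NormedModule) _ _ _ _ _ _
      (is_RInt_scal (V := R_NormedModule) _ _ _ (fst c) _ H1)
      (is_RInt_scal (V := R_NormedModule) _ _ _ (snd c) _ H2)).
  - exact (is_RInt_plus (V := R_NormedModule) _ _ _ _ _ _
      (is_RInt_scal (V := R_NormedModule) _ _ _ (fst c) _ H2)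
      (is_RInt_scal (V := R_NormedModule) _ _ _ (snd c) _ H1)).
Qed.

Lemma integral_to_infinity_scal (c : C) (g : R -> C) (v : C) :
  integral_to_infinity g v -> integral_to_infinity (fun s => c * g s) (c * v).
Proof.
  rewrite !integral_to_infinity_spec. intros H eps Heps. pose proof (Cmod_ge_0 c).
  destruct (H (eps / (Cmod c + 1))%R) as [B HB]; [apply Rdiv_lt_0_compat; lra|].
  exists B. intros b Hb. destruct (HB b Hb) as [I [HI HI']].
  exists (c * I). split; [now apply is_RInt_C_scal|].
  replace (c * I - c * v) with (c * (I - v)) by ring. rewrite Cmod_mult.
  apply Rle_lt_trans with (Cmod c * (eps / (Cmod c + 1)))%R.
  - apply Rmult_le_compat_l; lra.
  - apply Rlt_le_trans with ((Cmod c + 1) * (eps / (Cmod c + 1)))%R.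
    + apply Rmult_lt_compat_r; [apply Rdiv_lt_0_compat; lra|lra].
    + right. field. lra.
Qed.

Lemma integral_to_infinity_ext (g h : R -> C) (v : C) :
  (forall s, (0 <= s)%R -> g s = h s) -> integral_to_infinity g v -> integral_to_infinity h v.
Proof.
  rewrite !integral_to_infinity_spec. intros E H eps Heps.
  destruct (H eps Heps) as [B HB]. exists (Rmax B 0). intros b Hb.
  pose proof (Rmax_l B 0). pose proof (Rmax_r B 0).
  destruct (HB b ltac:(lra)) as [I [HI HI']]. exists I. split; [|exact HI'].
  eapply (is_RInt_ext (V := C_R_NormedModule)); [|exact HI].
  intros s. rewrite Rmin_left, Rmax_right by lra. intros Hs. apply E. lra.
Qed.

Lemma integral_to_infinity_bound (g : R -> C) (K eta : R) (v : C) :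
  (0 < eta)%R -> (0 <= K)%R ->
  (forall s, (0 <= s)%R -> (Cmod (g s) <= K * exp (- (eta * s)))%R) ->
  integral_to_infinity g v -> (Cmod v <= K / eta)%R.
Proof.
  intros He HK Hg Hv. destruct (Rle_lt_dec (Cmod v) (K / eta)) as [H|H]; [exact H|exfalso].
  destruct (proj1 (integral_to_infinity_spec g v) Hv (Cmod v - K / eta)%R) as [B HB]; [lra|].
  pose proof (Rmax_l B 0). pose proof (Rmax_r B 0).
  destruct (HB (Rmax B 0 + 1)%R ltac:(lra)) as [I [HI HI']].
  apply (RInt_decay_bound g K eta) in HI; [|assumption|assumption|lra|assumption].
  rewrite Rmult_0_r, Ropp_0, exp_0, Rmult_1_r in HI.
  assert (Cmod v <= Cmod I + Cmod (I - v))%R.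
  { replace v with (I + - (I - v)) at 1 by ring. rewrite <- (Cmod_opp (I - v)). apply Cmod_triangle. }
  lra.
Qed.

Lemma decay_vanish (K eta e : R) : (0 < eta)%R -> (0 <= K)%R -> (0 < e)%R ->
  exists B : R, (0 <= B)%R /\ forall b, (B < b)%R -> (K * exp (- (eta * b)) < e)%R.
Proof.
  (* For [b > K / (e eta)] one has [exp (eta b) >= eta b > K / e]. *)
  intros He HK Heps. exists (K / (e * eta))%R. split.
  { apply Rmult_le_pos; [exact HK|]. apply Rlt_le, Rinv_0_lt_compat. now apply Rmult_lt_0_compat. }
  intros a Ha. rewrite exp_Ropp. pose proof (exp_pos (eta * a)) as Hp.
  apply Rmult_lt_reg_r with (exp (eta * a))%R; [exact Hp|].
  rewrite Rmult_assoc, Rinv_l by lra. rewrite Rmult_1_r.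
  apply Rlt_le_trans with (e * (eta * a))%R.
  - replace K with (K / (e * eta) * (e * eta))%R at 1 by (field; lra).
    replace (e * (eta * a))%R with (a * (e * eta))%R by ring. apply Rmult_lt_compat_r; [|exact Ha].
    now apply Rmult_lt_0_compat.
  - apply Rmult_le_compat_l; [lra|]. apply exp_ge_id.
Qed.

(** Cauchy's criterion: the integral from [a] to any [b >= a] is at most
    [(K / eta) exp (- eta a)]. *)
Lemma integral_to_infinity_exists (g : R -> C) (K eta : R) :
  (0 < eta)%R -> (0 <= K)%R ->
  (forall s, (0 <= s)%R -> continuous (U := C_R_NormedModule) g s) ->
  (forall s, (0 <= s)%R -> (Cmod (g s) <= K * exp (- (eta * s)))%R) ->
  exists v : C, integral_to_infinity g v.
Proof.
  intros He HK Hc Hg.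
  assert (Hex : forall a b, (0 <= a)%R -> (0 <= b)%R ->
    is_RInt (V := C_R_CompleteNormedModule) g a b (RInt (V := C_R_CompleteNormedModule) g a b)).
  { intros a b Ha Hb. apply (RInt_correct (V := C_R_CompleteNormedModule)).
    apply (ex_RInt_continuous (V := C_R_CompleteNormedModule)). intros s Hs. apply Hc.
    revert Hs. unfold Rmin. destruct (Rle_dec a b); lra. }
  set (I := fun b => RInt (V := C_R_CompleteNormedModule) g 0 b : C).
  assert (Hdiff : forall a b, (0 <= a <= b)%R -> (Cmod (I b - I a) <= K / eta * exp (- (eta * a)))%R).
  { intros a b Hab. apply (RInt_decay_bound g K eta a b); try assumption.
    pose proof (is_RInt_Chasles (V := C_R_NormedModule) g a 0 b _ _
      (is_RInt_swap (V := C_R_NormedModule) _ _ _ _ (Hex 0%R a ltac:(lra) ltac:(lra)))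
      (Hex 0%R b ltac:(lra) ltac:(lra))) as HI.
    replace (I b - I a) with (plus (opp (I a)) (I b)); [exact HI|].
    change (- I a + I b = I b - I a). ring. }
  destruct (proj1 (filterlim_locally_cauchy (U := C_R_CompleteNormedModule) (F := Rbar_locally p_infty) I)) as [v Hv].
  { intros eps.
    destruct (decay_vanish (K / eta) eta eps He) as [B [HB0 HB]].
    { apply Rmult_le_pos; [exact HK|]. now apply Rlt_le, Rinv_0_lt_compat. }
    { apply cond_pos. }
    exists (fun b => (B < b)%R). split; [now exists B|].
    assert (Hball : forall a b, (B < a)%R -> (a <= b)%R -> (Cmod (I b - I a) < eps)%R).
    { intros a b Ha Hab. eapply Rle_lt_trans; [apply Hdiff; lra|]. now apply HB. }
    intros a b Ha Hb. apply (C_NormedModule_mixin_compat1).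
    destruct (Rle_lt_dec a b) as [Hab|Hab].
    - now apply Hball.
    - change (Cmod (I b - I a) < eps)%R. replace (I b - I a) with (- (I a - I b)) by ring.
      rewrite Cmod_opp. apply Hball; lra. }
  exists v. apply integral_to_infinity_spec. intros eps Heps.
  destruct (proj1 (filterlim_C (Rbar_locally p_infty) I v) Hv eps Heps) as [B HB].
  exists (Rmax B 0). intros b Hb. pose proof (Rmax_l B 0). pose proof (Rmax_r B 0).
  exists (I b). split; [apply Hex; lra|]. apply HB. lra.
Qed.

Lemma Cexp_continuous (c : C) (s : R) : continuous (U := C_R_NormedModule) (fun s : R => Cexp (c * s)) s.
Proof.
  apply derive_rel_curve_continuous with (c * Cexp (c * s)).
  apply (Cexp_scal_derive RtoC).
Qed.

Lemma continuous_C_mult (f g : R -> C) (s : R) :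
  continuous (U := C_R_NormedModule) f s -> continuous (U := C_R_NormedModule) g s ->
  continuous (U := C_R_NormedModule) (fun s => f s * g s) s.
Proof.
  intros Hf Hg. apply (filterlim_C (locally s)). intros eps Heps.
  pose proof (proj1 (filterlim_C (locally s) f (f s)) Hf) as Hf'.
  pose proof (proj1 (filterlim_C (locally s) g (g s)) Hg) as Hg'.
  pose proof (Cmod_ge_0 (f s)) as H1. pose proof (Cmod_ge_0 (g s)) as H2.
  set (d := Rmin 1 (eps / (Cmod (f s) + Cmod (g s) + 2))%R).
  assert (Hd : (0 < d)%R).
  { apply Rmin_pos; [lra|]. apply Rdiv_lt_0_compat; lra. }
  assert (Hd1 : (d <= 1)%R) by apply Rmin_l.
  assert (Hd2 : (d * (Cmod (f s) + Cmod (g s) + 2) <= eps)%R).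
  { apply Rle_trans with (eps / (Cmod (f s) + Cmod (g s) + 2) * (Cmod (f s) + Cmod (g s) + 2))%R.
    - apply Rmult_le_compat_r; [lra|apply Rmin_r].
    - right. field. lra. }
  generalize (filter_and _ _ (Hf' d Hd) (Hg' d Hd)). apply filter_imp. intros t [Hft Hgt].
  replace (f t * g t - f s * g s)
    with ((f t - f s) * (g t - g s) + ((f t - f s) * g s + f s * (g t - g s))) by ring.
  pose proof (Cmod_ge_0 (f t - f s)). pose proof (Cmod_ge_0 (g t - g s)).
  eapply Rle_lt_trans; [apply Cmod_triangle|].
  eapply Rle_lt_trans; [apply Rplus_le_compat_l, Cmod_triangle|]. rewrite !Cmod_mult.
  apply Rlt_le_trans with (d * (Cmod (f s) + Cmod (g s) + 2))%R; [|exact Hd2].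
  nra.
Qed.

Lemma continuous_C_plus (f g : R -> C) (s : R) :
  continuous (U := C_R_NormedModule) f s -> continuous (U := C_R_NormedModule) g s ->
  continuous (U := C_R_NormedModule) (fun s => f s + g s) s.
Proof. apply (continuous_plus (V := C_R_NormedModule)). Qed.

(** Half of the exponent pays for one factor [s], the other half for the remaining power by
    induction. *)
Lemma pow_exp_bound (j : nat) (eta : R) : (0 < eta)%R ->
  exists K : R, (0 <= K)%R /\ forall s, (0 <= s)%R -> (s ^ j <= K * exp (eta * s))%R.
Proof.
  revert eta. induction j as [|j IH]; intros eta He.
  - exists 1%R. split; [lra|]. intros s Hs. simpl.
    replace 1%R with (1 * exp 0)%R at 1 by (rewrite exp_0; ring).
    apply Rmult_le_compat_l; [lra|]. apply exp_le_mono. nra.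
  - destruct (IH (eta / 2)%R ltac:(lra)) as [K [HK0 HK]]. exists (2 / eta * K)%R. split.
    { apply Rmult_le_pos; [|exact HK0]. apply Rlt_le, Rdiv_lt_0_compat; lra. }
    intros s Hs. simpl.
    replace (exp (eta * s)) with (exp (eta / 2 * s) * exp (eta / 2 * s))%R
      by (rewrite <- exp_plus; f_equal; field).
    replace (2 / eta * K * (exp (eta / 2 * s) * exp (eta / 2 * s)))%R
      with ((2 / eta * exp (eta / 2 * s)) * (K * exp (eta / 2 * s)))%R by ring.
    apply Rmult_le_compat; [exact Hs|now apply pow_le| |now apply HK].
    replace s with (2 / eta * (eta / 2 * s))%R at 1 by (field; lra).
    apply Rmult_le_compat_l; [apply Rlt_le, Rdiv_lt_0_compat; lra|apply exp_ge_id].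
Qed.

(** On [w = z0 + i s] the damping is [e^(iuw) = e^(iuz0) e^(-us)]: up to a factor entire in [u], the
    damped integral is a Laplace transform along the ray. *)
Definition laplace (F : R -> C) (u v : C) : Prop :=
  integral_to_infinity (fun s => Cexp (- u * s) * F s) v.

Lemma laplace_plus (F1 F2 : R -> C) (u v1 v2 : C) :
  laplace F1 u v1 -> laplace F2 u v2 -> laplace (fun s => F1 s + F2 s) u (v1 + v2).
Proof.
  unfold laplace. intros H1 H2.
  apply (integral_to_infinity_ext (fun s : R => Cexp (- u * s) * F1 s + Cexp (- u * s) * F2 s)).
  - intros s _. ring.
  - now apply integral_to_infinity_plus.
Qed.

Lemma laplace_scal (k : C) (F : R -> C) (u v : C) :
  laplace F u v -> laplace (fun s => k * F s) u (k * v).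
Proof.
  unfold laplace. intros H.
  apply (integral_to_infinity_ext (fun s : R => k * (Cexp (- u * s) * F s))).
  - intros s _. ring.
  - now apply integral_to_infinity_scal.
Qed.

Lemma laplace_ext (F1 F2 : R -> C) (u v : C) :
  (forall s, (0 <= s)%R -> F1 s = F2 s) -> laplace F1 u v -> laplace F2 u v.
Proof.
  unfold laplace. intros E H.
  apply (integral_to_infinity_ext (fun s : R => Cexp (- u * s) * F1 s)); [|exact H].
  intros s Hs. now rewrite E.
Qed.

Lemma Cmod_Cexp_damping (u : C) (s : R) : Cmod (Cexp (- u * s)) = exp (- (Re u * s)).
Proof. rewrite Cmod_Cexp. destruct u as [x y]. simpl. f_equal. ring. Qed.

Definition decaying (F : R -> C) (eps K : R) : Prop :=
  (0 < eps)%R /\ (0 <= K)%R /\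
  (forall s, (0 <= s)%R -> continuous (U := C_R_NormedModule) F s) /\
  (forall s, (0 <= s)%R -> (Cmod (F s) <= K * exp (- (eps * s)))%R).

Lemma damped_decay (F : R -> C) (eps K : R) (u : C) (s : R) :
  decaying F eps K -> (0 <= s)%R ->
  (Cmod (Cexp (- u * s) * F s) <= K * exp (- ((eps + Re u) * s)))%R.
Proof.
  intros (He & HK & Hc & Hb) Hs. rewrite Cmod_mult, Cmod_Cexp_damping.
  replace (- ((eps + Re u) * s))%R with (- (Re u * s) + - (eps * s))%R by ring.
  rewrite exp_plus. specialize (Hb s Hs). pose proof (exp_pos (- (Re u * s))). nra.
Qed.

Lemma laplace_decaying_exists (F : R -> C) (eps K : R) (u : C) :
  decaying F eps K -> (- eps < Re u)%R -> exists v, laplace F u v.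
Proof.
  intros HF Hu. apply (integral_to_infinity_exists _ K (eps + Re u)); [lra|apply HF| |].
  - intros s Hs. apply continuous_C_mult; [apply Cexp_continuous|]. now apply HF.
  - intros s Hs. now apply damped_decay.
Qed.

(** Giving up [eps - eps'] of the decay rate absorbs the factor [s], by [x <= exp x]. *)
Lemma decaying_mult_id (F : R -> C) (eps eps' K : R) : (0 < eps' < eps)%R ->
  decaying F eps K -> decaying (fun s => s * F s) eps' (K / (eps - eps')).
Proof.
  intros He' (He & HK & Hc & Hb). split; [lra|]. split; [|split].
  - apply Rmult_le_pos; [exact HK|]. apply Rlt_le, Rinv_0_lt_compat. lra.
  - intros s Hs. apply continuous_C_mult; [|now apply Hc].
    apply derive_rel_curve_continuous with (RtoC 1). apply (derive_rel_id RtoC).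
  - intros s Hs. rewrite Cmod_mult, Cmod_R, Rabs_right by lra.
    apply Rle_trans with (s * (K * exp (- (eps * s))))%R.
    { apply Rmult_le_compat_l; [exact Hs|now apply Hb]. }
    replace (s * (K * exp (- (eps * s))))%R
      with (K / (eps - eps') * (((eps - eps') * s) * exp (- (eps * s))))%R by (field; lra).
    apply Rmult_le_compat_l.
    { apply Rmult_le_pos; [exact HK|]. apply Rlt_le, Rinv_0_lt_compat. lra. }
    replace (- (eps' * s))%R with ((eps - eps') * s + - (eps * s))%R by ring. rewrite exp_plus.
    apply Rmult_le_compat_r; [apply Rlt_le, exp_pos|apply exp_ge_id].
Qed.

Lemma laplace_decaying_derive (F : R -> C) (eps K : R) (Phi : C -> C) :
  decaying F eps K -> (forall u, (- eps < Re u)%R -> laplace F u (Phi u)) ->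
  forall u, (- eps < Re u)%R -> exists l, derive_rel (fun w => w) Phi u l.
Proof.
  intros HF HPhi u Hu. pose proof HF as (He & HK & Hc & Hb).
  set (eta := (eps + Re u)%R). assert (Heta : (0 < eta)%R) by (unfold eta; lra).
  assert (HM : exists m, laplace (fun s => s * F s) u m).
  (* The rate [eps'] must be positive, below [eps], and above [- Re u = eps - eta] so that the
     transform of [s F] still converges at [u]. *)
  { set (eps' := (Rmax (eps / 2) (eps - eta / 2))%R).
    assert (Heps' : (0 < eps' < eps)%R).
    { unfold eps'. pose proof (Rmax_l (eps / 2) (eps - eta / 2)). split; [lra|].
      apply Rmax_lub_lt; lra. }
    apply (laplace_decaying_exists _ eps' (K / (eps - eps')) u).
    - now apply decaying_mult_id.
    - pose proof (Rmax_r (eps / 2) (eps - eta / 2)). unfold eps', eta in *. lra. }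
  destruct HM as [m Hm]. exists (- m).
  (* With [t = eta s / 2] the damped [F] decays like [exp (- 2t)]; [|h| < eta / 4] costs
     [exp (t / 2)] and the squared remainder costs [4 exp t]. What is left, [exp (- eta s / 4)],
     integrates to the factor [1 / (eta / 4)], and 16 is 4 from [(2 / eta)^2] times this 4. *)
  apply derive_rel_quadratic with (eta / 4)%R (K * (16 / (eta * eta)) / (eta / 4))%R; [lra|].
  intros h Hh. pose proof (Cmod_ge_0 h) as Hh0.
  assert (Hre : (- (eta / 4) < Re h < eta / 4)%R).
  { pose proof (re_le_Cmod h) as H. apply Rabs_le_between in H. lra. }
  assert (HI : integral_to_infinity
    (fun s : R => Cexp (- u * s) * (Cexp (- h * s) - 1 - - h * s) * F s) (Phi (u + h) - Phi u - - m * h)).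
  { replace (Phi (u + h) - Phi u - - m * h) with (Phi (u + h) + (- (1) * Phi u + h * m)) by ring.
    apply integral_to_infinity_ext with (fun s : R => Cexp (- (u + h) * s) * F s
      + (- (1) * (Cexp (- u * s) * F s) + h * (Cexp (- u * s) * (s * F s)))).
    - intros s _. replace (- (u + h) * s) with (- u * s + - h * s) by ring. rewrite Cexp_plus. ring.
    - apply integral_to_infinity_plus; [|apply integral_to_infinity_plus].
      + apply HPhi. destruct u, h. simpl in *. unfold eta in *. lra.
      + apply integral_to_infinity_scal. now apply HPhi.
      + apply integral_to_infinity_scal. exact Hm. }
  replace (K * (16 / (eta * eta)) / (eta / 4) * (Cmod h * Cmod h))%R
    with (K * (16 / (eta * eta)) * (Cmod h * Cmod h) / (eta / 4))%R by (field; lra).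
  refine (integral_to_infinity_bound _ _ _ _ _ _ _ HI); [lra| |].
  { apply Rmult_le_pos; [apply Rmult_le_pos; [exact HK|]|nra].
    apply Rlt_le, Rdiv_lt_0_compat; nra. }
  intros s Hs.
  replace (Cexp (- u * s) * (Cexp (- h * s) - 1 - - h * s) * F s)
    with ((Cexp (- h * s) - 1 - - h * s) * (Cexp (- u * s) * F s)) by ring.
  rewrite Cmod_mult. set (t := (eta / 2 * s)%R). assert (Ht : (0 <= t)%R) by (unfold t; nra).
  assert (Hw : Cmod (- h * s) = (Cmod h * (2 / eta * t))%R).
  { rewrite Cmod_mult, Cmod_opp, Cmod_R, Rabs_right by lra. unfold t. field. lra. }
  assert (Hw' : (Cmod (- h * s) <= t / 2)%R).
  { rewrite Hw. apply Rle_trans with (eta / 4 * (2 / eta * t))%R.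
    - apply Rmult_le_compat_r; [|lra]. apply Rmult_le_pos; [|exact Ht].
      apply Rlt_le, Rdiv_lt_0_compat; lra.
    - right. field. lra. }
  apply Rle_trans with ((4 / (eta * eta) * (Cmod h * Cmod h) * (t * t)) * exp (t / 2)
     * (K * exp (- (2 * t))))%R.
  { apply Rmult_le_compat; try apply Cmod_ge_0.
    - eapply Rle_trans; [apply Cexp_taylor_bound|]. apply Rmult_le_compat.
      + pose proof (Cmod_ge_0 (- h * s)). nra.
      + apply Rlt_le, exp_pos.
      + rewrite Hw. right. field. lra.
      + now apply exp_le_mono.
    - eapply Rle_trans; [now apply (damped_decay F eps K)|]. fold eta. right. unfold t.
      do 3 f_equal. field. }
  assert (HC : (0 <= 4 / (eta * eta) * K * (Cmod h * Cmod h))%R).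
  { apply Rmult_le_pos; [apply Rmult_le_pos; [|exact HK]|nra].
    apply Rlt_le, Rdiv_lt_0_compat; nra. }
  replace (4 / (eta * eta) * (Cmod h * Cmod h) * (t * t) * exp (t / 2) * (K * exp (- (2 * t))))%R
    with (4 / (eta * eta) * K * (Cmod h * Cmod h) * ((t * t) * (exp (t / 2) * exp (- (2 * t)))))%R by ring.
  apply Rle_trans with (4 / (eta * eta) * K * (Cmod h * Cmod h) * ((4 * exp t) * (exp (t / 2) * exp (- (2 * t)))))%R.
  { apply Rmult_le_compat_l; [exact HC|]. apply Rmult_le_compat_r; [|now apply exp_ge_square].
    apply Rmult_le_pos; apply Rlt_le, exp_pos. }
  replace (4 * exp t * (exp (t / 2) * exp (- (2 * t))))%R with (4 * exp (- (eta / 4 * s)))%R.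
  2:{ replace (- (eta / 4 * s))%R with (t + (t / 2 + - (2 * t)))%R by (unfold t; field).
      rewrite !exp_plus. ring. }
  right. field. lra.
Qed.

(* The part [Re u > c] where the transform converges, joined to a neighbourhood
   of 0 by a wedge that meets the real axis left of 1 only. *)
Definition wedge (c eps : R) (u : C) : Prop :=
  (c < Re u)%R \/ (- eps < Re u /\ Re u - 1 < Im u)%R.

(** Convergence is required only to the right of [c], holomorphy on the whole wedge. [cont_vanish]
    disposes of the boundary term at infinity in the integration by parts. *)
Record continuable (F : R -> C) (c eps : R) (Phi : C -> C) : Prop := {
  cont_eps : (0 < eps)%R;
  cont_derive : forall u, wedge c eps u -> exists l, derive_rel (fun w => w) Phi u l;
  cont_laplace : forall u, (c < Re u)%R -> laplace F u (Phi u);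
  cont_vanish : forall u, (c < Re u)%R -> forall e, (0 < e)%R -> exists B : R,
    forall b : R, (B < b)%R -> (Cmod (Cexp (- u * b) * F b) < e)%R
}.

Lemma decaying_continuable (F : R -> C) (eps K : R) :
  decaying F eps K -> exists Phi, continuable F 0 eps Phi.
Proof.
  intros HF. pose proof HF as (He & HK & Hc & Hb).
  set (Phi := fun u => RInt_gen (V := C_R_CompleteNormedModule)
    (fun s => Cexp (- u * s) * F s) (at_point 0%R) (Rbar_locally p_infty) : C).
  assert (HPhi : forall u, (- eps < Re u)%R -> laplace F u (Phi u)).
  { intros u Hu.
    exact (RInt_gen_correct (V := C_R_CompleteNormedModule) (Fa := at_point 0%R)
      (Fb := Rbar_locally p_infty) (fun s : R => Cexp (- u * s) * F s)
      (laplace_decaying_exists F eps K u HF Hu)). }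
  exists Phi. split.
  - exact He.
  - intros u Hu. apply (laplace_decaying_derive F eps K Phi HF HPhi).
    destruct Hu as [Hu|Hu]; lra.
  - intros u Hu. apply HPhi. lra.
  - intros u Hu e Hep. destruct (decay_vanish K (eps + Re u) e) as [B [HB0 HB]]; [lra|exact HK|exact Hep|].
    exists B. intros b Hbb. eapply Rle_lt_trans; [apply (damped_decay F eps K u b HF); lra|now apply HB].
Qed.

(** This is [j! / (u - l)^(j+1)], the transform of [s^j exp(l s)], in the recursive shape that
    integration by parts produces. *)
Fixpoint exp_poly_laplace (l : R) (j : nat) (u : C) : C :=
  match j with
  | O => / (u - l)
  | S j' => INR j * exp_poly_laplace l j' u * / (u - l)
  end.

Definition exp_poly (l : R) (j : nat) (s : R) : C := RtoC (s ^ j * exp (l * s)).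

Lemma Cexp_exp_poly (l : R) (j : nat) (u : C) (s : R) :
  Cexp (- u * s) * exp_poly l j s = RtoC s ^ j * Cexp (- (u - l) * s).
Proof.
  unfold exp_poly. rewrite RtoC_mult, RtoC_pow, <- Cexp_R, RtoC_mult.
  replace (- (u - l) * s) with (- u * s + l * s) by ring. rewrite Cexp_plus. ring.
Qed.

Lemma exp_poly_vanish (l : R) (j : nat) (u : C) : (l < Re u)%R ->
  forall e, (0 < e)%R -> exists B : R, (0 <= B)%R /\
    forall b : R, (B < b)%R -> (Cmod (Cexp (- u * b) * exp_poly l j b) < e)%R.
Proof.
  intros Hu e He. set (eta := (Re u - l)%R).
  destruct (pow_exp_bound j (eta / 2)) as [K [HK0 HK]]; [unfold eta; lra|].
  destruct (decay_vanish K (eta / 2) e) as [B [HB0 HB]]; [unfold eta; lra|exact HK0|exact He|].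
  exists B. split; [exact HB0|]. intros b Hb. eapply Rle_lt_trans; [|apply (HB b Hb)].
  rewrite Cexp_exp_poly, Cmod_mult, Cmod_pow, Cmod_R, Rabs_right, Cmod_Cexp_damping by lra.
  replace (Re (u - l)) with eta by (destruct u; unfold eta; simpl; ring).
  apply Rle_trans with (K * exp (eta / 2 * b) * exp (- (eta * b)))%R.
  { apply Rmult_le_compat_r; [apply Rlt_le, exp_pos|]. apply HK. lra. }
  rewrite Rmult_assoc, <- exp_plus. right. do 2 f_equal. field.
Qed.

Lemma derive_rel_RtoC_pow (j : nat) (s : R) :
  derive_rel RtoC (fun s : R => RtoC s ^ S j) s (INR (S j) * RtoC s ^ j).
Proof.
  induction j as [|j IH].
  - replace (INR 1 * RtoC s ^ 0) with (1 * RtoC 1) by (simpl; ring).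
    apply (derive_rel_ext RtoC (fun s : R => 1 * RtoC s)); [intros; simpl; ring|].
    apply derive_rel_scal, derive_rel_id.
  - replace (INR (S (S j)) * RtoC s ^ S j) with
      (1 * RtoC s ^ S j + RtoC s * (INR (S j) * RtoC s ^ j))
      by (rewrite (S_INR (S j)), RtoC_plus; simpl; ring).
    apply (derive_rel_mult RtoC RtoC (fun s : R => RtoC s ^ S j)); [apply derive_rel_id|exact IH].
Qed.

Lemma Cexp_linear_derive (u : C) (s : R) :
  derive_rel RtoC (fun s : R => Cexp (u * s)) s (u * Cexp (u * s)).
Proof. apply (Cexp_scal_derive RtoC). Qed.

(** Integration by parts, with two uses: it computes the transforms of monomials, and it passes from
    the transform of a primitive to that of the integrand. *)
Lemma laplace_derivative (F F' : R -> C) (u v : C) :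
  (forall s, (0 <= s)%R -> derive_rel RtoC F s (F' s)) ->
  (forall s, (0 <= s)%R -> continuous (U := C_R_NormedModule) F' s) ->
  (forall e, (0 < e)%R -> exists B : R,
     forall b : R, (B < b)%R -> (Cmod (Cexp (- u * b) * F b) < e)%R) ->
  laplace F u v -> laplace F' u (u * v - F 0%R).
Proof.
  intros HF HF' Hvan Hv.
  set (H := fun s : R => Cexp (- u * s) * F s).
  set (dH := fun s : R => - u * Cexp (- u * s) * F s + Cexp (- u * s) * F' s).
  assert (HdH : integral_to_infinity dH (- F 0%R)).
  { apply integral_to_infinity_spec. intros eps Heps. destruct (Hvan eps Heps) as [B HB].
    exists (Rmax B 0). intros b Hb. pose proof (Rmax_l B 0). pose proof (Rmax_r B 0).
    exists (H b - H 0%R). split.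
    - apply FTC_curve; intros s; rewrite Rmin_left, Rmax_right by lra; intros Hs.
      + apply (derive_rel_mult RtoC (fun s : R => Cexp (- u * s)) F);
          [apply Cexp_linear_derive|apply HF; lra].
      + apply continuous_C_plus; apply continuous_C_mult.
        * apply continuous_C_mult; [|apply Cexp_continuous].
          apply (continuous_const (U := R_UniformSpace) (V := C_R_NormedModule)).
        * apply derive_rel_curve_continuous with (F' s). apply HF. lra.
        * apply Cexp_continuous.
        * apply HF'. lra.
    - replace (H b - H 0%R - - F 0%R) with (H b); [apply HB; lra|].
      unfold H. rewrite Cmult_0_r, Cexp_0. ring. }
  unfold laplace.
  apply integral_to_infinity_ext with (fun s => dH s + u * (Cexp (- u * s) * F s)).
  { intros s _. unfold dH. ring. }
  replace (u * v - F 0%R) with (- F 0%R + u * v) by ring.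
  apply integral_to_infinity_plus; [exact HdH|]. now apply integral_to_infinity_scal.
Qed.

(** Domination gives existence only; the value is then forced by integration by parts, starting from
    [mu L(1) - 1 = 0] and continuing with [mu L(s^(j+1)) = (j + 1) L(s^j)]. *)
Lemma monomial_laplace (j : nat) (mu : C) : (0 < Re mu)%R ->
  laplace (fun s : R => RtoC s ^ j) mu (exp_poly_laplace 0 j mu).
Proof.
  intros Hmu.
  assert (Hmu0 : mu <> 0) by (intros ->; simpl in Hmu; lra).
  assert (Hcont : forall i (s : R), continuous (U := C_R_NormedModule) (fun s : R => RtoC s ^ i) s).
  { intros [|i] s.
    - apply (continuous_const (U := R_UniformSpace) (V := C_R_NormedModule)).
    - eapply derive_rel_curve_continuous. apply derive_rel_RtoC_pow. }
  assert (Hex : forall i, exists v, laplace (fun s : R => RtoC s ^ i) mu v).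
  { intros i. destruct (pow_exp_bound i (Re mu / 2)) as [K [HK0 HK]]; [lra|].
    apply (integral_to_infinity_exists _ K (Re mu / 2)); [lra|exact HK0| |].
    - intros s _. apply continuous_C_mult; [apply Cexp_continuous|apply Hcont].
    - intros s Hs. rewrite Cmod_mult, Cmod_Cexp_damping, Cmod_pow, Cmod_R, Rabs_right by lra.
      replace (- (Re mu * s))%R with (- (Re mu / 2 * s) + - (Re mu / 2 * s))%R by field.
      rewrite exp_plus. rewrite (Rmult_assoc (exp _)), (Rmult_comm (exp _)).
      apply Rmult_le_compat_r; [apply Rlt_le, exp_pos|].
      rewrite exp_Ropp. pose proof (exp_pos (Re mu / 2 * s)) as Hp.
      apply Rmult_le_reg_l with (exp (Re mu / 2 * s)); [exact Hp|].
      rewrite <- Rmult_assoc, Rinv_r, Rmult_1_l by lra. rewrite Rmult_comm. now apply HK. }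
  assert (Hvan : forall i e, (0 < e)%R -> exists B : R,
     forall b : R, (B < b)%R -> (Cmod (Cexp (- mu * b) * RtoC b ^ i) < e)%R).
  { intros i e He. destruct (exp_poly_vanish 0 i mu Hmu e He) as [B [_ HB]]. exists B.
    intros b Hb. specialize (HB b Hb). unfold exp_poly in HB.
    rewrite Rmult_0_l, exp_0, Rmult_1_r, RtoC_pow in HB. exact HB. }
  induction j as [|j IH].
  - destruct (Hex O) as [v Hv].
    assert (E : mu * v - 1 = 0).
    { apply (integral_to_infinity_unique (fun s : R => Cexp (- mu * s) * 0)).
      - apply (laplace_derivative (fun _ => 1) (fun _ => 0)); [| |apply (Hvan O)|exact Hv].
        + intros s _. apply (derive_rel_const RtoC).
        + intros s _. apply (continuous_const (U := R_UniformSpace) (V := C_R_NormedModule)).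
      - apply integral_to_infinity_ext with (fun s : R => 0 * (Cexp (- mu * s) * RtoC s ^ 0)).
        { intros s _. ring. }
        pose proof (integral_to_infinity_scal 0 _ v Hv) as H0. rewrite Cmult_0_l in H0. exact H0. }
    simpl exp_poly_laplace. replace (/ (mu - 0)) with v; [exact Hv|].
    replace v with ((mu * v - 1 + 1) / mu) by (field; exact Hmu0). rewrite E. field.
    replace (mu - 0) with mu by ring. auto.
  - destruct (Hex (S j)) as [v Hv].
    assert (E : mu * v - 0 ^ S j = INR (S j) * exp_poly_laplace 0 j mu).
    { apply (integral_to_infinity_unique (fun s : R => Cexp (- mu * s) * (INR (S j) * RtoC s ^ j))).
      - apply (laplace_derivative (fun s : R => RtoC s ^ S j) (fun s : R => INR (S j) * RtoC s ^ j));
          [| |apply (Hvan (S j))|exact Hv].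
        + intros s _. apply derive_rel_RtoC_pow.
        + intros s _. apply continuous_C_mult; [|apply Hcont].
          apply (continuous_const (U := R_UniformSpace) (V := C_R_NormedModule)).
      - apply integral_to_infinity_ext with (fun s : R => INR (S j) * (Cexp (- mu * s) * RtoC s ^ j)).
        { intros s _. ring. }
        now apply integral_to_infinity_scal. }
    cbn [exp_poly_laplace]. rewrite <- E.
    replace ((mu * v - 0 ^ S j) * / (mu - 0)) with v; [exact Hv|].
    rewrite Cpow_S. field. replace (mu - 0) with mu by ring. auto.
Qed.

Lemma exp_poly_laplace_shift (l : R) (j : nat) (u : C) :
  exp_poly_laplace l j u = exp_poly_laplace 0 j (u - l).
Proof.
  induction j as [|j IH]; cbn [exp_poly_laplace].
  - f_equal. ring.
  - rewrite IH. f_equal. f_equal. ring.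
Qed.

(** The bound [1 <= l] keeps the real pole [l] out of the wedge: it is not to the right of [l], and
    on the real axis the other half of the wedge stays below 1. The exponents that occur are at
    least [2 pi]. *)
Lemma exp_poly_continuable (l : R) (j : nat) : (1 <= l)%R ->
  continuable (exp_poly l j) l 1 (exp_poly_laplace l j).
Proof.
  intros Hl. split; [lra| | |].
  - intros u Hu.
    assert (Hu0 : u - l <> 0).
    { intros E. assert (u = RtoC l) as -> by (replace u with (u - l + l) by ring; rewrite E; ring).
      unfold wedge in Hu. simpl in Hu. lra. }
    assert (Hinv : derive_rel (fun w => w) (fun w => / (w - l)) u (- (1 + 0) / ((u - l) * (u - l)))).
    { apply (derive_rel_inv (fun w => w) (fun w => w - l)); [exact Hu0|].
      apply (derive_rel_plus (fun w => w) (fun w => w) (fun _ => - l)); [apply derive_rel_id|apply derive_rel_const]. }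
    induction j as [|j [d Hd]].
    + exists (- (1 + 0) / ((u - l) * (u - l))). exact Hinv.
    + eexists. cbn [exp_poly_laplace].
      apply (derive_rel_mult (fun w => w) (fun w => INR (S j) * exp_poly_laplace l j w));
        [|exact Hinv].
      apply derive_rel_scal. exact Hd.
  - intros u Hu. rewrite exp_poly_laplace_shift.
    apply (integral_to_infinity_ext (fun s : R => Cexp (- (u - l) * s) * RtoC s ^ j)
      (fun s : R => Cexp (- u * s) * exp_poly l j s)).
    { intros s _. rewrite Cexp_exp_poly. ring. }
    apply (monomial_laplace j (u - l)). destruct u. simpl in *. lra.
  - intros u Hu e He. destruct (exp_poly_vanish l j u Hu e He) as [B [_ HB]]. now exists B.
Qed.

Lemma wedge_mono (c eps c' eps' : R) (u : C) :
  (c <= c')%R -> (eps' <= eps)%R -> wedge c' eps' u -> wedge c eps u.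
Proof. intros Hc He [H|H]; [left|right]; lra. Qed.

Lemma continuable_mono (F : R -> C) (c eps c' eps' : R) (Phi : C -> C) :
  (c <= c')%R -> (0 < eps' <= eps)%R -> continuable F c eps Phi -> continuable F c' eps' Phi.
Proof.
  intros Hc He H. split; [lra| | |].
  - intros u Hu. apply (cont_derive _ _ _ _ H). apply wedge_mono with c' eps'; [lra|lra|exact Hu].
  - intros u Hu. apply (cont_laplace _ _ _ _ H). lra.
  - intros u Hu. apply (cont_vanish _ _ _ _ H). lra.
Qed.

Lemma continuable_plus (F1 F2 : R -> C) (c eps : R) (Phi1 Phi2 : C -> C) :
  continuable F1 c eps Phi1 -> continuable F2 c eps Phi2 ->
  continuable (fun s => F1 s + F2 s) c eps (fun u => Phi1 u + Phi2 u).
Proof.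
  intros H1 H2. split; [apply H1| | |].
  - intros u Hu. destruct (cont_derive _ _ _ _ H1 u Hu) as [l1 Hl1].
    destruct (cont_derive _ _ _ _ H2 u Hu) as [l2 Hl2].
    exists (l1 + l2). now apply derive_rel_plus.
  - intros u Hu.
    apply laplace_plus; [now apply (cont_laplace _ _ _ _ H1)|now apply (cont_laplace _ _ _ _ H2)].
  - intros u Hu e He.
    destruct (cont_vanish _ _ _ _ H1 u Hu (e / 2)%R) as [B1 HB1]; [lra|].
    destruct (cont_vanish _ _ _ _ H2 u Hu (e / 2)%R) as [B2 HB2]; [lra|].
    exists (Rmax B1 B2). intros b Hb. pose proof (Rmax_l B1 B2). pose proof (Rmax_r B1 B2).
    specialize (HB1 b ltac:(lra)). specialize (HB2 b ltac:(lra)).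
    rewrite Cmult_plus_distr_l. eapply Rle_lt_trans; [apply Cmod_triangle|]. lra.
Qed.

Lemma continuable_scal (k : C) (F : R -> C) (c eps : R) (Phi : C -> C) :
  continuable F c eps Phi -> continuable (fun s => k * F s) c eps (fun u => k * Phi u).
Proof.
  intros H. split; [apply H| | |].
  - intros u Hu. destruct (cont_derive _ _ _ _ H u Hu) as [l Hl].
    exists (k * l). now apply derive_rel_scal.
  - intros u Hu. apply laplace_scal. now apply (cont_laplace _ _ _ _ H).
  - intros u Hu e He. pose proof (Cmod_ge_0 k).
    destruct (cont_vanish _ _ _ _ H u Hu (e / (Cmod k + 1))%R) as [B HB].
    { apply Rdiv_lt_0_compat; lra. }
    exists B. intros b Hb. specialize (HB b Hb).
    replace (Cexp (- u * b) * (k * F b)) with (k * (Cexp (- u * b) * F b)) by ring.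
    rewrite Cmod_mult. pose proof (Cmod_ge_0 (Cexp (- u * b) * F b)).
    apply Rle_lt_trans with ((Cmod k + 1) * Cmod (Cexp (- u * b) * F b))%R; [nra|].
    replace e with ((Cmod k + 1) * (e / (Cmod k + 1)))%R by (field; lra).
    apply Rmult_lt_compat_l; lra.
Qed.

(** Generators and closure rules replace a normal form, so that continuation and multiplication by
    [s] are both proved by induction. The generators leave out [l = 0], whose transform has its pole
    at [u = 0]. *)
Inductive tame : (R -> C) -> Prop :=
| tame_decaying (F : R -> C) (eps K : R) : decaying F eps K -> tame F
| tame_exp_poly (l : R) (j : nat) : (1 <= l)%R -> tame (exp_poly l j)
| tame_plus (F1 F2 : R -> C) : tame F1 -> tame F2 -> tame (fun s => F1 s + F2 s)
| tame_scal (k : C) (F : R -> C) : tame F -> tame (fun s => k * F s)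
| tame_ext (F1 F2 : R -> C) :
    (forall s, (0 <= s)%R -> F1 s = F2 s) -> tame F1 -> tame F2.

Lemma tame_continuable (F : R -> C) : tame F -> exists c eps Phi, continuable F c eps Phi.
Proof.
  induction 1 as [F eps K HF|l j Hl|F1 F2 _ IH1 _ IH2|k F _ IH|F1 F2 E _ IH].
  - exists 0%R, eps. now apply decaying_continuable with K.
  - exists l, 1%R, (exp_poly_laplace l j). now apply exp_poly_continuable.
  - destruct IH1 as (c1 & e1 & Phi1 & H1). destruct IH2 as (c2 & e2 & Phi2 & H2).
    pose proof (cont_eps _ _ _ _ H1). pose proof (cont_eps _ _ _ _ H2).
    exists (Rmax c1 c2), (Rmin e1 e2), (fun u => Phi1 u + Phi2 u).
    apply continuable_plus.
    + apply continuable_mono with c1 e1; [apply Rmax_l| |exact H1].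
      split; [now apply Rmin_pos|apply Rmin_l].
    + apply continuable_mono with c2 e2; [apply Rmax_r| |exact H2].
      split; [now apply Rmin_pos|apply Rmin_r].
  - destruct IH as (c & e & Phi & H). exists c, e, (fun u => k * Phi u).
    now apply continuable_scal.
  - destruct IH as (c & e & Phi & H). exists c, e, Phi. split; [apply H|apply H| |].
    + intros u Hu. apply (laplace_ext F1 F2 u _ E). now apply (cont_laplace _ _ _ _ H).
    + intros u Hu eps Heps. destruct (cont_vanish _ _ _ _ H u Hu eps Heps) as [B HB].
      exists (Rmax B 0). intros b Hb. pose proof (Rmax_l B 0). pose proof (Rmax_r B 0).
      rewrite <- E by lra. apply HB. lra.
Qed.

(** A linear form [b z + c] is affine in [s] on a vertical ray, so the brackets multiply by [s].
    Decaying parts lose half their rate, exponential polynomials gain a degree. *)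
Lemma tame_mult_id (F : R -> C) : tame F -> tame (fun s => s * F s).
Proof.
  induction 1 as [F eps K HF|l j Hl|F1 F2 _ IH1 _ IH2|k F _ IH|F1 F2 E _ IH].
  - eapply tame_decaying. apply (decaying_mult_id F eps (eps / 2) K); [|exact HF].
    destruct HF as [He _]. lra.
  - apply tame_ext with (exp_poly l (S j)); [|now apply tame_exp_poly].
    intros s _. unfold exp_poly. simpl. rewrite <- RtoC_mult. f_equal. ring.
  - apply tame_ext with (fun s : R => s * F1 s + s * F2 s); [intros; ring|]. now apply tame_plus.
  - apply tame_ext with (fun s : R => k * (s * F s)); [intros; ring|]. now apply tame_scal.
  - apply tame_ext with (fun s : R => s * F1 s); [|exact IH]. intros s Hs. now rewrite E.
Qed.

(** * Behaviour along vertical rays *)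

Definition ray (z0 : C) (s : R) : C := z0 + Ci * s.

Lemma ray_Im (z0 : C) (s : R) : Im (ray z0 s) = (Im z0 + s)%R.
Proof. destruct z0. unfold ray. simpl. ring. Qed.

Lemma ray_H (z0 : C) (s : R) : upper_half_plane z0 -> (0 <= s)%R -> upper_half_plane (ray z0 s).
Proof. unfold upper_half_plane. rewrite ray_Im. lra. Qed.

Lemma ray_derive (z0 : C) (s : R) : derive_rel RtoC (ray z0) s Ci.
Proof.
  replace Ci with (0 + Ci) by ring.
  apply (derive_rel_plus RtoC (fun _ => z0) (fun s => Ci * s)).
  - apply (derive_rel_const RtoC).
  - apply (derive_rel_linear RtoC).
Qed.

Lemma derive_rel_ray (f : C -> C) (z0 l : C) (s : R) :
  derive_rel (fun w => w) f (ray z0 s) l -> derive_rel RtoC (fun s => f (ray z0 s)) s (l * Ci).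
Proof. intros H. apply (derive_rel_comp RtoC f (ray z0)); [exact H|apply ray_derive]. Qed.

Lemma qexp_ray (n : nat) (z0 : C) (s : R) :
  qexp n (ray z0 s) = qexp n z0 * exp (- (2 * PI * INR n * s)).
Proof.
  unfold qexp. rewrite <- Cexp_R, <- Cexp_plus. f_equal. unfold ray.
  rewrite RtoC_opp, !RtoC_mult.
  replace (2 * PI * Ci * INR n * (z0 + Ci * s))
    with (2 * PI * Ci * INR n * z0 + (Ci * Ci) * (2 * PI * INR n * s)) by ring.
  replace (Ci * Ci) with (- RtoC 1) by (apply injective_projections; simpl; ring).
  ring.
Qed.

Fixpoint qsum (a : nat -> C) (m : nat) (z : C) : C :=
  match m with
  | O => 0
  | S m' => qsum a m' z + a m' * qexp m' z
  end.

(** A term [q^(m - N)] with [m < N] grows along the ray like [exp (2 pi (N - m) s)], with exponent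
    at least 1. Continuity is recorded because the remainder, a difference with [F], must be
    continuous to count as decaying. *)
Lemma principal_part_tame (a : nat -> C) (N m : nat) (z0 : C) : (m <= N)%nat ->
  exists F : R -> C, tame F /\
    (forall s, continuous (U := C_R_NormedModule) F s) /\
    (forall s, qexp N (ray z0 s) * F s = qsum a m (ray z0 s)).
Proof.
  intros Hm. induction m as [|m IH].
  (* The zero function, written as a multiple of a generator. *)
  - exists (fun s => 0 * exp_poly 1 0 s). split; [apply tame_scal, tame_exp_poly; lra|].
    split; [|intros s; simpl; ring].
    intros s. apply (continuous_ext (T := R_UniformSpace) (U := C_R_NormedModule) (fun _ => RtoC 0)).
    + intros t. now rewrite Cmult_0_l.
    + apply (continuous_const (U := R_UniformSpace) (V := C_R_NormedModule)).
  - destruct IH as [F [HF [HFc HFe]]]; [lia|].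
    set (l := (2 * PI * INR (N - m))%R).
    assert (Hl : (1 <= l)%R).
    { unfold l. assert (1 <= INR (N - m))%R by (apply (le_INR 1); lia).
      pose proof PI2_1. nra. }
    set (c := a m * qexp m z0 / qexp N z0).
    exists (fun s => F s + c * exp_poly l 0 s). split; [|split].
    + apply tame_plus; [exact HF|]. now apply tame_scal, tame_exp_poly.
    + intros s. apply continuous_C_plus; [apply HFc|]. apply continuous_C_mult.
      * apply (continuous_const (U := R_UniformSpace) (V := C_R_NormedModule)).
      * apply (continuous_ext (T := R_UniformSpace) (U := C_R_NormedModule) (fun s : R => Cexp (l * s))).
        -- intros t. unfold exp_poly. rewrite <- RtoC_mult, Cexp_R. f_equal. simpl. ring.
        -- apply Cexp_continuous.
    + intros s. rewrite Cmult_plus_distr_l, HFe. cbn [qsum]. f_equal.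
      rewrite !qexp_ray. unfold c, exp_poly.
      replace (exp (- (2 * PI * INR m * s)))
        with (exp (- (2 * PI * INR N * s)) * (s ^ 0 * exp (l * s)))%R.
      * rewrite !RtoC_mult. field. apply qexp_neq_0.
      * simpl. rewrite Rmult_1_l, <- exp_plus. f_equal. unfold l. rewrite minus_INR by lia. ring.
Qed.

Lemma expansion_tame (N : nat) (a : nat -> C) (f : C -> C) (z0 : C) :
  expansion N a f -> upper_half_plane z0 -> tame (fun s => f (ray z0 s) - a N).
Proof.
  intros H Hz0. pose proof PI_RGT_0 as HPI.
  destruct (principal_part_tame a N N z0 (le_n N)) as [F [HF [HFc HFe]]].
  set (T := fun s : R => f (ray z0 s) + - a N + - (1) * F s).
  apply tame_ext with (fun s : R => F s + T s); [intros s _; unfold T; ring|].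
  apply tame_plus; [exact HF|].
  set (y := Im z0). unfold upper_half_plane in Hz0. fold y in Hz0.
  destruct (qseries_decay a _ y Hz0 H) as [M [HM0 HM]].
  set (x := (PI * y)%R). assert (Hx : (0 < x)%R) by (apply Rmult_lt_0_compat; lra).
  pose proof (geometric_exp_series x Hx) as Hg. set (K := (/ (1 - exp (- x)))%R) in *.
  assert (HK : (0 <= K)%R).
  { apply Rlt_le, Rinv_0_lt_compat.
    assert (exp (- x) < exp 0)%R by (apply exp_increasing; lra). rewrite exp_0 in H0. lra. }
  apply (tame_decaying T (2 * PI) (M * K * exp (2 * PI * INR N * y))). split; [|split; [|split]].
  - lra.
  - apply Rmult_le_pos; [now apply Rmult_le_pos|apply Rlt_le, exp_pos].
  - intros s Hs. unfold T.
    apply continuous_C_plus; [apply continuous_C_plus|apply continuous_C_mult].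
    + destruct (expansion_calD N a f H) as [Hd _].
      eapply derive_rel_curve_continuous. apply derive_rel_ray. apply Hd.
      now apply ray_H.
    + apply (continuous_const (U := R_UniformSpace) (V := C_R_NormedModule)).
    + apply (continuous_const (U := R_UniformSpace) (V := C_R_NormedModule)).
    + apply HFc.
  - intros s Hs. set (z := ray z0 s).
    assert (Hz : upper_half_plane z) by now apply ray_H.
    assert (HIm : Im z = (y + s)%R) by apply ray_Im.
    assert (Hsum : forall m, sum_n (G := C_NormedModule) (fun n => a n * qexp n z) m = qsum a (S m) z).
    { induction m as [|m IHm].
      - rewrite sum_O. simpl. ring.
      - rewrite sum_Sn, IHm. reflexivity. }
    (* Indices below [N] form the principal part and index [N] the constant term, so the remainder
       starts at [S N], that is with [q^1] after division by [q^N]. *)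
    assert (HS : C_series (fun k => a (S N + k)%nat * qexp (S N + k) z) (qexp N z * T s)).
    { refine (is_series_incr_n (K := C_AbsRing) (V := C_NormedModule)
        (fun n => a n * qexp n z) (S N) (qexp N z * T s) (Nat.lt_0_succ N) _).
      simpl Init.Nat.pred. rewrite Hsum. cbn [qsum].
      assert (Eq : qexp N z * f z = qexp N z * T s + (qsum a N z + a N * qexp N z)).
      { unfold z. rewrite <- HFe. unfold T. ring. }
      pose proof (H z Hz) as HSz. rewrite Eq in HSz. exact HSz. }
    (* As [2 Im z - y = y + 2s], the term of index [N + 1 + k] is at most [M E exp (- k x)]: the
       [s]-part of the fixed [N + 1] units gives [E], the [y]-part of the other [k] units the
       geometric series. Dividing by [|q^N|] leaves the decay [exp (- 2 pi s)]. *)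
    set (E := exp (- (2 * PI * (INR N + 1) * s))).
    assert (HB : (Cmod (qexp N z * T s) <= M * E * K)%R).
    { apply (C_series_bound _ (fun k => M * E * exp (- (INR k * x)))%R _ _ HS).
      - apply (is_series_scal (K := R_AbsRing) (V := R_NormedModule)). exact Hg.
      - intros k. eapply Rle_trans; [apply HM; lra|]. rewrite Rmult_assoc.
        apply Rmult_le_compat_l; [exact HM0|]. unfold E. rewrite <- exp_plus.
        apply exp_le_mono. rewrite HIm. unfold x.
        rewrite plus_INR, S_INR. pose proof (pos_INR k). pose proof (pos_INR N).
        assert (0 <= (INR N + 1) * (PI * y))%R by (apply Rmult_le_pos; nra).
        assert (0 <= INR k * (PI * s))%R by (apply Rmult_le_pos; nra).
        nra. }
    rewrite Cmod_mult, Cmod_qexp, HIm in HB.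
    apply Rmult_le_reg_l with (exp (- (2 * PI * INR N * (y + s)))); [apply exp_pos|].
    eapply Rle_trans; [exact HB|]. right. unfold E.
    replace (exp (- (2 * PI * (INR N + 1) * s)))
      with (exp (- (2 * PI * INR N * (y + s))) * exp (2 * PI * INR N * y) * exp (- (2 * PI * s)))%R.
    + ring.
    + rewrite <- !exp_plus. f_equal. ring.
Qed.

(** With [qa Q = 0] the undifferentiated term drops out and [Q'] is constant; only the next two
    orders have to be tame, so a constant term in [g i] does no harm. *)
Lemma jet_step_tame (Q : bqf) (r : nat) (g : nat -> C -> C) (i : nat) (z0 : C) :
  qa Q = 0%Z ->
  tame (fun s => g (S i) (ray z0 s)) -> tame (fun s => g (S (S i)) (ray z0 s)) ->
  tame (fun s => jet_step Q r g i (ray z0 s)).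
Proof.
  intros Ha H1 H2.
  set (b := ZtoC (qb Q)). set (c := ZtoC (qc Q)).
  apply tame_ext with (fun s : R =>
    ((b * z0 + c) * g (S (S i)) (ray z0 s) + (b * Ci) * (s * g (S (S i)) (ray z0 s)))
    + ((INR i - (2 * INR r + 1)) * b) * g (S i) (ray z0 s)).
  - intros s _. unfold jet_step, bqf_eval, bqf_diff. rewrite Ha. fold b c.
    change (ZtoC 0) with (RtoC 0). unfold ray. ring.
  - apply tame_plus; [apply tame_plus|].
    + now apply tame_scal.
    + apply tame_scal. now apply (tame_mult_id (fun s => g (S (S i)) (ray z0 s))).
    + now apply tame_scal.
Qed.

Lemma primitive_tame (Q : bqf) (r : nat) (g : nat -> C -> C) (z0 : C) :
  qa Q = 0%Z -> (forall i, tame (fun s => g i (ray z0 s))) ->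
  tame (fun s => primitive Q r g (ray z0 s)).
Proof.
  intros Ha. revert g. induction r as [|r IH]; intros g Hg; simpl; [apply Hg|].
  apply IH. intros i. now apply jet_step_tame.
Qed.

(* For r > 0 only derivatives of f enter, which have no constant term. *)
Lemma primitive_expansion_tame (N : nat) (a : nat -> C) (f : C -> C) (r : nat) :
  expansion N a f -> exists kappa : C, forall (Q : bqf) (z0 : C),
    qa Q = 0%Z -> upper_half_plane z0 ->
    tame (fun s => primitive Q r (deriv_jet f) (ray z0 s) - kappa).
Proof.
  intros H. destruct r as [|r].
  - exists (a N). intros Q z0 _ Hz0.
    apply tame_ext with (fun s : R => f (ray z0 s) - a N); [|now apply (expansion_tame N)].
    intros s _. simpl. unfold deriv_jet. simpl. ring.
  - exists 0. intros Q z0 Ha Hz0.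
    assert (Hd : forall i, tame (fun s => deriv_jet f (S i) (ray z0 s))).
    { intros i. apply tame_scal.
      apply tame_ext with (fun s : R => calD_n (S i) f (ray z0 s) - iter_coef N a (S i) N).
      - intros s _. cbn [iter_coef]. ring.
      - apply (expansion_tame N); [now apply expansion_calD_n|exact Hz0]. }
    apply tame_ext with (fun s : R => primitive Q (S r) (deriv_jet f) (ray z0 s)); [intros; ring|].
    simpl. apply primitive_tame; [exact Ha|]. intros i. now apply jet_step_tame.
Qed.

(** * Regularized integrals *)

Lemma wedge_open (c eps : R) : open (wedge c eps).
Proof.
  intros [x y] Hu.
  assert (Hd : exists d : R, (0 < d)%R /\ forall x' y' : R,
    (Rabs (x' - x) < d)%R -> (Rabs (y' - y) < d)%R -> wedge c eps (x', y')).
  { destruct Hu as [Hu|[Hu1 Hu2]]; simpl in *.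
    - exists (x - c)%R. split; [lra|]. intros x' y' Hx _. left. simpl.
      apply Rabs_def2 in Hx. lra.
    - exists (Rmin (x + eps) ((y - x + 1) / 2)). split; [apply Rmin_pos; lra|].
      intros x' y' Hx Hy. pose proof (Rmin_l (x + eps) ((y - x + 1) / 2)).
      pose proof (Rmin_r (x + eps) ((y - x + 1) / 2)).
      apply Rabs_def2 in Hx, Hy. right. simpl. lra. }
  destruct Hd as [d [Hd H]]. exists (mkposreal d Hd). intros [x' y'] [Hx Hy]. now apply H.
Qed.

(** The supremum [m] of the parameters up to which the segment stays in [A] belongs to [A] and
    cannot be less than 1. *)
Lemma segment_connected (A B : C -> Prop) (p q : C) : open A -> open B ->
  (forall t : R, (0 <= t <= 1)%R ->
     (A (p + t * (q - p)) \/ B (p + t * (q - p))) /\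
     ~ (A (p + t * (q - p)) /\ B (p + t * (q - p)))) ->
  A p -> A q.
Proof.
  intros HA HB Hcov HAp.
  set (g := fun t : R => p + t * (q - p)).
  assert (Hloc : forall (P : C -> Prop) t, open P -> P (g t) -> exists d : R, (0 < d)%R /\
    forall t', (Rabs (t' - t) < d)%R -> P (g t')).
  { intros P t HP Ht.
    assert (Hg : continuous (U := C_R_NormedModule) g t).
    { apply derive_rel_curve_continuous with (0 + (q - p)).
      apply (derive_rel_plus RtoC (fun _ => p) (fun t => t * (q - p))); [apply (derive_rel_const RtoC)|].
      apply (derive_rel_ext RtoC (fun t : R => (q - p) * t)); [intros; ring|].
      apply (derive_rel_linear RtoC). }
    destruct (Hg P (HP _ Ht)) as [d Hd]. exists d. split; [apply cond_pos|exact Hd]. }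
  set (E := fun t => (0 <= t <= 1)%R /\ forall t', (0 <= t' <= t)%R -> A (g t')).
  assert (Hg0 : g 0%R = p) by (unfold g; ring).
  assert (Hg1 : g 1%R = q) by (unfold g; ring).
  destruct (completeness E) as [m [Hub Hlub]].
  { exists 1%R. intros t [Ht _]. lra. }
  { exists 0%R. split; [lra|]. intros t' Ht'. replace t' with 0%R by lra. now rewrite Hg0. }
  assert (Hm : (0 <= m <= 1)%R).
  { split.
    - apply Hub. split; [lra|]. intros t' Ht'. replace t' with 0%R by lra. now rewrite Hg0.
    - apply Hlub. intros t [Ht _]. lra. }
  assert (Hbelow : forall t, (0 <= t < m)%R -> A (g t)).
  { intros t Ht. destruct (Classical_Prop.classic (exists s, E s /\ (t < s)%R)) as [[s [[_ Hs] Hts]]|Hno].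
    - apply Hs. lra.
    - exfalso. assert (m <= t)%R; [|lra]. apply Hlub. intros s Hs.
      destruct (Rle_lt_dec s t) as [Hst|Hst]; [exact Hst|]. exfalso. apply Hno. now exists s. }
  (* Otherwise [B], being open, would contain points just before [m], which lie in [A]. *)
  assert (HAm : A (g m)).
  { destruct (proj1 (Hcov m Hm)) as [H|H]; [exact H|exfalso].
    destruct (Hloc B m HB H) as [d [Hd Hd']].
    destruct (Req_dec m 0) as [E0|E0].
    - apply (proj2 (Hcov m Hm)). split; [|exact H]. fold (g m). rewrite E0, Hg0. exact HAp.
    - set (t := Rmax 0 (m - d / 2)).
      assert (Ht : (0 <= t < m)%R) by (unfold t, Rmax; destruct (Rle_dec 0 (m - d / 2)); lra).
      assert (Ht' : (m - d < t)%R) by (unfold t; pose proof (Rmax_r 0 (m - d / 2)); lra).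
      apply (proj2 (Hcov t ltac:(lra))). split; [now apply Hbelow|].
      apply Hd'. apply Rabs_def1; lra. }
  destruct (Hloc A m HA HAm) as [d [Hd Hd']].
  destruct (Rle_lt_dec 1 m) as [H1|H1].
  { rewrite <- Hg1. replace 1%R with m by lra. exact HAm. }
  exfalso. set (t := Rmin 1 (m + d / 2)).
  assert (Ht : (m < t <= 1)%R /\ (t <= m + d / 2)%R).
  { unfold t. pose proof (Rmin_l 1 (m + d / 2)). pose proof (Rmin_r 1 (m + d / 2)).
    unfold Rmin in *. destruct (Rle_dec 1 (m + d / 2)); lra. }
  assert (HE : E t).
  { split; [lra|]. intros t' Ht'. destruct (Rlt_le_dec t' m) as [H|H].
    - apply Hbelow. lra.
    - apply Hd'. apply Rabs_def1; lra. }
  pose proof (Hub t HE). lra.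
Qed.

Lemma convex_pos (a b t : R) :
  (0 < a)%R -> (0 < b)%R -> (0 <= t <= 1)%R -> (0 < a + t * (b - a))%R.
Proof.
  intros Ha Hb [H0 H1]. destruct (Rle_lt_dec a b) as [H|H]; nra.
Qed.

Lemma wedge_connected (c eps : R) : (0 < eps)%R -> connected_set (wedge c eps).
Proof.
  intros He (A & B & HA & HB & Hcov & Hdis & [za [Hza HAz]] & [zb [Hzb HBz]]).
  (* The wedge is a union of two convex sets, and [p] is chosen in both: [x0 > c], [x0 > - eps] and
     [x0 - 1 < x0]. Hence the wedge is star-shaped about [p]. *)
  set (x0 := (Rmax c 0 + 1)%R). set (p := (x0, x0) : C).
  pose proof (Rmax_l c 0). pose proof (Rmax_r c 0).
  assert (Hseg : forall w, wedge c eps w -> forall t, (0 <= t <= 1)%R -> wedge c eps (w + t * (p - w))).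
  { intros [x y] Hw t Ht. destruct Hw as [Hw|[Hw1 Hw2]]; [left|right]; unfold p; simpl in *.
    - pose proof (convex_pos (x - c) (x0 - c) t ltac:(lra) ltac:(unfold x0; lra) Ht). lra.
    - pose proof (convex_pos (x + eps) (x0 + eps) t ltac:(lra) ltac:(unfold x0; lra) Ht).
      pose proof (convex_pos (y - x + 1) 1 t ltac:(lra) ltac:(lra) Ht). lra. }
  assert (Hseg' : forall w, wedge c eps w -> forall t, (0 <= t <= 1)%R -> wedge c eps (p + t * (w - p))).
  { intros w Hw t Ht. replace (p + t * (w - p)) with (w + (1 - t)%R * (p - w))
      by (rewrite RtoC_minus; ring).
    apply Hseg; [exact Hw|lra]. }
  assert (HAp : A p).
  { apply (segment_connected A B za p HA HB); [|exact HAz]. intros t Ht.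
    pose proof (Hseg za Hza t Ht) as Hw. split; [now apply Hcov|now apply Hdis]. }
  assert (HAb : A zb).
  { apply (segment_connected A B p zb HA HB); [|exact HAp]. intros t Ht.
    pose proof (Hseg' zb Hzb t Ht) as Hw. split; [now apply Hcov|now apply Hdis]. }
  now apply (Hdis zb).
Qed.

(** It is the transform [Phi] of the primitive that is continued. In [u Phi u - F 0] the first term
    vanishes at [u = 0] because [Phi] is finite there, so the continuation of [Phi] never has to be
    evaluated. *)
Lemma reg_integral_of_primitive (f P : C -> C) (kappa z0 : C) :
  upper_half_plane z0 ->
  (forall w, upper_half_plane w -> derive_rel (fun w => w) P w (f w)) ->
  (forall w, upper_half_plane w -> exists l, derive_rel (fun w => w) f w l) ->
  tame (fun s => P (ray z0 s) - kappa) ->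
  is_reg_integral f z0 (kappa - P z0).
Proof.
  intros Hz0 HP Hf Ht.
  set (F := fun s : R => P (ray z0 s) - kappa).
  destruct (tame_continuable F Ht) as (c & eps & Phi & HPhi).
  assert (Hr0 : ray z0 0 = z0) by (unfold ray; ring).
  (* The exponential is the factor [e^(iuz0)] by which the damping on the ray differs from
     [e^(-us)]; it equals 1 at [u = 0]. *)
  exists (wedge c eps), (fun u => Cexp (Ci * z0 * u) * (u * Phi u + - F 0%R)), c.
  split; [apply wedge_open|]. split; [apply wedge_connected; apply HPhi|].
  split; [|split; [|split]].
  - intros u Hu. destruct (cont_derive _ _ _ _ HPhi u Hu) as [l Hl].
    eexists. apply Cderive_rel.
    apply derive_rel_mult; [apply (Cexp_scal_derive (fun w => w))|].
    apply derive_rel_plus; [|apply derive_rel_const].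
    apply derive_rel_mult; [apply derive_rel_id|exact Hl].
  - intros u Hu. split; [now left|].
    pose proof (laplace_derivative F (fun s => f (ray z0 s) * Ci) u (Phi u)) as HL.
    assert (Hd : laplace (fun s => f (ray z0 s) * Ci) u (u * Phi u - F 0%R)).
    { apply HL.
      - intros s Hs. unfold F.
        replace (f (ray z0 s) * Ci) with (f (ray z0 s) * Ci + 0) by ring.
        apply (derive_rel_plus RtoC (fun s => P (ray z0 s)) (fun _ => - kappa)).
        + apply derive_rel_ray, HP. now apply ray_H.
        + apply (derive_rel_const RtoC).
      - intros s Hs. apply continuous_C_mult.
        + destruct (Hf (ray z0 s) (ray_H z0 s Hz0 Hs)) as [l Hl].
          eapply derive_rel_curve_continuous. apply derive_rel_ray. exact Hl.
        + apply (continuous_const (U := R_UniformSpace) (V := C_R_NormedModule)).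
      - apply (cont_vanish _ _ _ _ HPhi u Hu).
      - now apply (cont_laplace _ _ _ _ HPhi). }
    apply (integral_to_infinity_ext
      (fun s : R => Cexp (Ci * z0 * u) * (Cexp (- u * s) * (f (ray z0 s) * Ci)))).
    + intros s _. fold (ray z0 s).
      replace (u * Ci * ray z0 s) with (Ci * z0 * u + - u * s).
      * rewrite Cexp_plus. ring.
      * unfold ray.
        replace (u * Ci * (z0 + Ci * s)) with (Ci * z0 * u + (Ci * Ci) * (u * s)) by ring.
        replace (Ci * Ci) with (- RtoC 1) by (apply injective_projections; simpl; ring). ring.
    + exact (integral_to_infinity_scal (Cexp (Ci * z0 * u)) _ _ Hd).
  - right. simpl. pose proof (cont_eps _ _ _ _ HPhi). lra.
  - rewrite Cmult_0_r, Cexp_0. unfold F. rewrite Hr0. ring.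
Qed.

(** * Cycle integrals *)

Lemma calD_n_primitive (k N : nat) (a : nat -> C) (G : C -> C) (Q : bqf) (z : C) :
  (1 <= k)%nat -> expansion N a G -> upper_half_plane z ->
  derive_rel (fun w => w)
    (fun w => / (2 * PI * Ci) ^ (2 * k - 1) * primitive Q (k - 1) (deriv_jet G) w) z
    (calD_n (2 * k - 1) G z * bqf_eval Q z ^ (k - 1)).
Proof.
  intros Hk HG Hz.
  pose proof (Cpow_nz _ (2 * k - 1) two_pi_i_neq_0) as Hc.
  replace (calD_n (2 * k - 1) G z * bqf_eval Q z ^ (k - 1)) with
    (/ (2 * PI * Ci) ^ (2 * k - 1) *
       (bqf_eval Q z ^ (k - 1) * deriv_jet G (2 * (k - 1) + 1) z)).
  - apply derive_rel_scal, primitive_derive; [|exact Hz]. exact (deriv_jet_jet N a G HG).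
  - replace (2 * (k - 1) + 1)%nat with (2 * k - 1)%nat by lia. unfold deriv_jet.
    set (c := (2 * PI * Ci) ^ (2 * k - 1)) in *. field. exact Hc.
Qed.

Lemma calD_n_integrand_derive (k N : nat) (a : nat -> C) (G : C -> C) (Q : bqf) (z : C) :
  expansion N a G -> upper_half_plane z -> exists l,
  derive_rel (fun w => w) (fun w => calD_n (2 * k - 1) G w * bqf_eval Q w ^ (k - 1)) z l.
Proof.
  intros HG Hz.
  destruct (expansion_calD _ _ _ (expansion_calD_n N a G (2 * k - 1) HG)) as [Hd _].
  assert (Hp : forall n, exists l, derive_rel (fun w => w) (fun w => bqf_eval Q w ^ n) z l).
  { induction n as [|n [l Hl]].
    - exists 0. exact (derive_rel_const (fun w => w) 1 z).
    - eexists. apply (derive_rel_mult (fun w => w) (bqf_eval Q) (fun w => bqf_eval Q w ^ n));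
        [apply bqf_eval_derive|exact Hl]. }
  destruct (Hp (k - 1)%nat) as [l Hl].
  eexists. apply derive_rel_mult; [now apply Hd|exact Hl].
Qed.

Lemma Cpow_Z_of_nat (z : C) (n : nat) : Cpow_Z z (Z.of_nat n) = z ^ n.
Proof.
  destruct n as [|n]; [reflexivity|].
  simpl Z.of_nat. unfold Cpow_Z. now rewrite SuccNat2Pos.id_succ.
Qed.

(** Modularity enters only here. In weight [2 - 2k] it reads [G z = J^(2(k-1)) G(g z)], which is the
    hypothesis of [primitive_mobius] with the jet of [G] on both sides. *)
Lemma primitive_invariant (k N : nat) (a : nat -> C) (G : C -> C) (Q : bqf) (g : mat2) (z : C) :
  (1 <= k)%nat -> expansion N a G ->
  (forall (g : mat2) (z : C), SL2Z g -> upper_half_plane z ->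
    slash (2 - 2 * Z.of_nat k)%Z G g z = G z) ->
  SL2Z g -> upper_half_plane z ->
  primitive Q (k - 1) (deriv_jet G) (mobius g z) = primitive (bqf_comp Q g) (k - 1) (deriv_jet G) z.
Proof.
  intros Hk HG Hmod Hg Hz.
  pose proof (deriv_jet_jet N a G HG) as Hj.
  apply primitive_mobius; try assumption.
  intros w Hw. unfold deriv_jet. simpl (calD_n 0 G _). rewrite <- (Hmod g w Hg Hw) at 1.
  unfold slash. fold (automorphy g w).
  replace (- (2 - 2 * Z.of_nat k))%Z with (Z.of_nat (2 * (k - 1))) by lia.
  rewrite Cpow_Z_of_nat. simpl (_ ^ 0). ring.
Qed.

(** Bezout completes the reduced vector [(p', q')] to the first column of a matrix of determinant 1;
    the leading coefficient of [Q o g] is then [Q(p', q') = 0]. *)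
Lemma rational_root_cusp (Q : bqf) (p q : Z) : (q <> 0)%Z ->
  (qa Q * p * p + qb Q * p * q + qc Q * q * q = 0)%Z ->
  exists g : mat2, SL2Z g /\ maps_infinity_to g (Some (IZR p / IZR q)%R) /\
    qa (bqf_comp Q g) = 0%Z.
Proof.
  intros Hq H. set (d := Z.gcd p q).
  assert (Hd : (d <> 0)%Z).
  { intros E. apply Z.gcd_eq_0 in E. lia. }
  destruct (Z.gcd_divide_l p q) as [p' Hp']. destruct (Z.gcd_divide_r p q) as [q' Hq'].
  fold d in Hp', Hq'.
  destruct (Z.gcd_bezout p q d eq_refl) as [u [v Huv]].
  assert (Hdet : (u * p' + v * q' = 1)%Z).
  { apply (Z.mul_cancel_r _ _ d Hd). rewrite Hp', Hq' in Huv at 1. lia. }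
  assert (Hq0 : (q' <> 0)%Z) by (intros ->; lia).
  exists (Mat2 p' (- v) q' u). split; [|split].
  - unfold SL2Z. simpl. lia.
  - split; [exact Hq0|]. simpl. rewrite Hp', Hq', !mult_IZR. field.
    split; now apply eq_IZR_contrapositive.
  - destruct Q as [a b c]. cbn [qa qb qc bqf_comp] in *.
    rewrite Hp', Hq' in H.
    apply (Z.mul_cancel_r _ _ (d * d)); [now apply Z.neq_mul_0|]. rewrite Z.mul_0_l, <- H. ring.
Qed.

Lemma sqrt_square_disc (D m : Z) : D = (m * m)%Z -> sqrt (IZR D) = IZR (Z.abs m).
Proof.
  intros ->. rewrite mult_IZR, abs_IZR. apply sqrt_Rsqr_abs.
Qed.

Lemma S_start_cusp (Q : bqf) (m : Z) : (0 < bqf_disc Q)%Z -> bqf_disc Q = (m * m)%Z ->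
  exists g : mat2, SL2Z g /\ maps_infinity_to g (S_start Q) /\ qa (bqf_comp Q g) = 0%Z.
Proof.
  intros HD Hm. unfold S_start. rewrite (sqrt_square_disc _ m Hm).
  destruct (Z.eqb_spec (qa Q) 0) as [Ha|Ha].
  - rewrite <- opp_IZR. apply rational_root_cusp.
    + intros Hb. unfold bqf_disc in HD. rewrite Ha, Hb in HD. lia.
    + rewrite Ha. ring.
  - rewrite <- opp_IZR, <- plus_IZR, <- mult_IZR. apply rational_root_cusp; [lia|].
    transitivity (qa Q * (Z.abs m * Z.abs m - bqf_disc Q))%Z; [unfold bqf_disc; ring|].
    rewrite Hm, Z.abs_square. ring.
Qed.

Lemma S_end_cusp (Q : bqf) (m : Z) : (0 < bqf_disc Q)%Z -> bqf_disc Q = (m * m)%Z ->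
  exists g : mat2, SL2Z g /\ maps_infinity_to g (S_end Q) /\ qa (bqf_comp Q g) = 0%Z.
Proof.
  intros HD Hm. unfold S_end. rewrite (sqrt_square_disc _ m Hm).
  destruct (Z.eqb_spec (qa Q) 0) as [Ha|Ha].
  - exists (Mat2 1 0 0 1). split; [reflexivity|]. split; [reflexivity|].
    destruct Q as [a b c]. simpl in *. lia.
  - rewrite <- opp_IZR, <- minus_IZR, <- mult_IZR. apply rational_root_cusp; [lia|].
    transitivity (qa Q * (Z.abs m * Z.abs m - bqf_disc Q))%Z; [unfold bqf_disc; ring|].
    rewrite Hm, Z.abs_square. ring.
Qed.

(** In weight 2 the slash action is the pullback of the differential [f dw], since [J^(-2)] is the
    derivative of the Moebius map. *)
Lemma slash_2_primitive (f P : C -> C) (g : mat2) (z : C) :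
  SL2Z g -> upper_half_plane z ->
  (forall w, upper_half_plane w -> derive_rel (fun w => w) P w (f w)) ->
  derive_rel (fun w => w) (fun w => P (mobius g w)) z (slash 2 f g z).
Proof.
  intros Hg Hz HP. pose proof (automorphy_neq_0 g z Hg Hz) as HJ.
  replace (slash 2 f g z) with (f (mobius g z) * (1 / (automorphy g z * automorphy g z))).
  - apply (derive_rel_comp (fun w => w) P (mobius g)); [|now apply mobius_derive].
    apply HP. now apply mobius_H.
  - unfold slash. fold (automorphy g z). simpl. field. exact HJ.
Qed.

Lemma slash_2_derive (f : C -> C) (g : mat2) (z : C) :
  SL2Z g -> upper_half_plane z ->
  (forall w, upper_half_plane w -> exists l, derive_rel (fun w => w) f w l) ->
  exists l, derive_rel (fun w => w) (slash 2 f g) z l.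
Proof.
  intros Hg Hz Hf. pose proof (automorphy_neq_0 g z Hg Hz) as HJ.
  destruct (Hf _ (mobius_H g z Hg Hz)) as [l Hl].
  assert (HJd : derive_rel (fun w => w) (automorphy g) z (ZtoC (m21 g) + 0)).
  { apply derive_rel_plus; [apply derive_rel_linear|apply derive_rel_const]. }
  eexists. unfold slash. simpl Z.opp. unfold Cpow_Z.
  apply (derive_rel_mult (fun w => w) (fun w => / automorphy g w ^ Pos.to_nat 2)
    (fun w => f (mobius g w))).
  - apply derive_rel_inv; [now apply Cpow_nz|]. apply derive_rel_pow; [exact HJ|exact HJd].
  - apply (derive_rel_comp (fun w => w) f (mobius g)); [exact Hl|now apply mobius_derive].
Qed.

Theorem corollary1p2 :
  forall (k : nat), (1 <= k)%nat ->
  forall (G : C -> C), weakly_holomorphic (2 - 2 * Z.of_nat k)%Z G ->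
  forall (D : Z), discriminant D -> (0 < D)%Z ->
  forall (Q : bqf), bqf_disc Q = D ->
  is_cycle_integral k (calD_n (2 * k - 1)%nat G) Q (RtoC 0).
Proof.
  intros k Hk G [_ Hmod [N [a HG]]] D _ HD Q <-.
  change (expansion N a G) in HG.
  set (f := fun z => calD_n (2 * k - 1) G z * bqf_eval Q z ^ (k - 1)).
  set (c := / (2 * PI * Ci) ^ (2 * k - 1)).
  set (P := fun w => c * primitive Q (k - 1) (deriv_jet G) w).
  assert (HP : forall w, upper_half_plane w -> derive_rel (fun w => w) P w (f w)).
  { intros w Hw. now apply (calD_n_primitive k N a). }
  assert (Hf : forall w, upper_half_plane w -> exists l, derive_rel (fun w => w) f w l).
  { intros w Hw. now apply (calD_n_integrand_derive k N a). }
  split.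
  - intros [m Hm].
    destruct (primitive_expansion_tame N a G (k - 1) HG) as [kappa Hkappa].
    (* The value involves neither [g] nor the cusp [x]; this independence is what makes the two
       cusps cancel. *)
    assert (Hcusp : forall (g : mat2) (x : option R) (z0 : C),
      SL2Z g -> maps_infinity_to g x -> qa (bqf_comp Q g) = 0%Z -> upper_half_plane z0 ->
      is_reg_integral_to_cusp f z0 x (c * kappa - P z0)).
    { intros g x z0 Hg Hx Ha Hz0. exists g. split; [exact Hg|]. split; [exact Hx|].
      pose proof (mobius_H _ z0 (SL2Z_inv g Hg) Hz0) as Hz1.
      (* [P z0] becomes the value of [P o g], a primitive of the slashed integrand, at the base
         point [g^(-1) z0]. *)
      rewrite <- (mobius_inv g z0 Hg Hz0) at 2.
      apply (reg_integral_of_primitive (slash 2 f g) (fun w => P (mobius g w))).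
      - exact Hz1.
      - intros w Hw. now apply slash_2_primitive.
      - intros w Hw. now apply slash_2_derive.
      - apply tame_ext with (fun s : R => c *
          (primitive (bqf_comp Q g) (k - 1) (deriv_jet G) (ray (mobius (mat2_inv g) z0) s) - kappa)).
        + intros s Hs. unfold P.
          rewrite (primitive_invariant k N a G Q g _ Hk HG Hmod Hg (ray_H _ s Hz1 Hs)). ring.
        + now apply tame_scal, Hkappa. }
    intros z0 Hz0.
    destruct (S_start_cusp Q m HD Hm) as (ga & Hga & Hxa & Haa).
    destruct (S_end_cusp Q m HD Hm) as (gb & Hgb & Hxb & Hab).
    exists (c * kappa - P z0), (c * kappa - P z0).
    split; [now apply (Hcusp ga)|]. split; [now apply (Hcusp gb)|]. ring.
  - intros Hsq g Hg z Hz.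
    destruct (is_gQ_automorphism Q g HD Hg) as [Hg1 HgQ].
    assert (Ha : qa Q <> 0%Z).
    { intros Ha. apply Hsq. exists (qb Q). unfold bqf_disc. rewrite Ha. ring. }
    replace (RtoC 0) with (P (mobius g z) - P z).
    + apply arc_integral_primitive; try assumption. now apply S_set_mobius.
    + unfold P. rewrite (primitive_invariant k N a G Q g z Hk HG Hmod Hg1 (proj1 Hz)), HgQ. ring.
Qed.
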